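(* Let $u\in\mathbb{C}$ with $\mathrm{Re}(u)>0$. Then \[ \sum_{m=1}^{\infty}\int_{0}^{\infty}\frac{t\cos(t)}{t^2+m^2u^2}\,\mathrm{d}t=\frac{1}{2}\left\{\log\left(\frac{u}{2\pi}\right)-\frac{1}{2}\left(\psi\left(\frac{iu}{2\pi}\right)+\psi\left(\frac{-iu}{2\pi}\right)\right)\right\}. \]
   Context: $\psi=\Gamma'/\Gamma$ is the digamma function and $\log$ is the principal branch of the logarithm. *)

(* Defs.v *)
From Stdlib Require Import Reals Factorial.
From Coquelicot Require Import Coquelicot.

Local Open Scope R_scope.

Definition Cexp (z : C) : C :=
  (exp (Re z) * cos (Im z), exp (Re z) * sin (Im z)).

Definition Carg (z : C) : R :=
  if Rlt_dec 0 (Re z) then atan (Im z / Re z)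
  else if Rlt_dec (Re z) 0 then
    (if Rle_dec 0 (Im z) then atan (Im z / Re z) + PI
     else atan (Im z / Re z) - PI)
  else if Rlt_dec 0 (Im z) then PI / 2
  else if Rlt_dec (Im z) 0 then - (PI / 2)
  else 0.

Definition Clog (z : C) : C := (ln (Cmod z), Carg z).

Fixpoint Cpoch (z : C) (n : nat) : C :=
  match n with
  | O => z
  | S k => Cmult (Cpoch z k) (Cplus z (RtoC (INR (S k))))
  end.

Definition gauss_seq (z : C) (n : nat) : C :=
  Cdiv (Cmult (RtoC (INR (Factorial.fact n))) (Cexp (Cmult z (RtoC (ln (INR n))))))
       (Cpoch z n).

(** Euler's Gamma function on C \ {0,-1,-2,...}, as the limit of the Gauss product. *)
Definition CGamma (z : C) : C :=
  @lim C_R_CompleteNormedModule (filtermap (gauss_seq z) eventually).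

Definition CDerive (f : C -> C) (z : C) : C :=
  @lim C_R_CompleteNormedModule
    (filtermap (fun h : C => Cdiv (Cminus (f (Cplus z h)) (f z)) h)
               (@locally' C_UniformSpace (RtoC 0))).

Definition digamma (z : C) : C := Cdiv (CDerive CGamma z) (CGamma z).

Definition integrand (u : C) (m : nat) (t : R) : C :=
  Cdiv (RtoC (t * cos t))
       (Cplus (RtoC (t ^ 2)) (Cmult (RtoC (INR m ^ 2)) (Cmult u u))).

(* Main.v *)
(** Put [w = i u / (2 PI)].  The substitution [t = 2 PI m x] turns the [m]-th integral into half the
    sum over [z = w, - w] of [J_m z], the integral over [0 <= x] of [cos (2 PI m x) / (x + z)].
    The Poisson (Euler-Maclaurin) formula for [1 / (x + z)] on the half-line says that
    [sum_m J_m z] is half the limit of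
    [1 / (2 z) + sum_(1 <= k <= n) 1 / (k + z) - int_0^n 1 / (x + z) dx],
    that is [(log z - 1 / (2 z) - psi z) / 2], because
    [psi z = lim (ln n - sum_(k <= n) 1 / (z + k))].  Adding the two values of [z] cancels [1 / (2 z)]
    and gives [log w + log (- w) = 2 log (u / (2 PI))]. *)

Require Import Defs.
From Stdlib Require Import Reals Lra Lia Factorial.
From Coquelicot Require Import Coquelicot.

Local Open Scope R_scope.

(** * Dirichlet kernels *)

(** When [f] decays only like [1 / x], the integral of [f (x) cos (2 PI m x)] over the half-line
    converges conditionally, and the sum over [m] cannot be moved inside it. Two integrations by
    parts on each [[k, k + 1]] replace the Dirichlet kernel by a second primitive that vanishes at
    the integers and tends to 0 uniformly, paired with [f''], which is absolutely integrable; the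
    resulting bound holds for all upper limits [n] at once. As [w] and [- w] are not real,
    [1 / (x + z)] is smooth on the whole line, and its real and imaginary parts are treated as two
    real functions. The second obstacle is that [digamma] is built from two abstract limits, a Gauss
    product and a difference quotient. One exact factorisation reaches both: the Gauss product at
    [z + h] is the one at [z], times the exponential of [h] times [digamma_seq z n], times a finite
    product that is [1 + O(h^2)] uniformly in [n]. Letting [n] grow gives the derivative of Gamma
    and the limit formula for [psi] together. *)

Lemma dominated_increment (f g df dg : R -> R) (a b : R) :
  a <= b ->
  (forall x, a <= x <= b -> is_derive f x (df x)) ->
  (forall x, a <= x <= b -> is_derive g x (dg x)) ->
  (forall x, a <= x <= b -> Rabs (df x) <= dg x) ->
  Rabs (f b - f a) <= g b - g a.
Proof.
  intros Hab Hf Hg Hd.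
  (* With [s] a sign, the two halves of the absolute value are the monotonicity of [g + s f]. *)
  assert (Hs : forall s, s = 1 \/ s = -1 -> 0 <= (g b + s * f b) - (g a + s * f a)).
  { intros s Hs.
    destruct (MVT_gen (fun x => g x + s * f x) a b (fun x => dg x + s * df x)) as [c [Hc ->]].
    - intros x Hx. rewrite Rmin_left, Rmax_right in Hx by lra.
      apply (is_derive_plus (V := R_NormedModule)); [apply Hg; lra|].
      apply is_derive_scal, Hf; lra.
    - intros x Hx. rewrite Rmin_left, Rmax_right in Hx by lra.
      apply continuity_pt_plus.
      + apply derivable_continuous_pt. exists (dg x). apply is_derive_Reals, Hg; lra.
      + apply continuity_pt_scal, derivable_continuous_pt.
        exists (df x). apply is_derive_Reals, Hf; lra.
    - rewrite Rmin_left, Rmax_right in Hc by lra.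
      specialize (Hd c Hc). apply Rabs_le_between in Hd.
      apply Rmult_le_pos; [destruct Hs; subst s; lra | lra]. }
  generalize (Hs 1 (or_introl eq_refl)) (Hs (-1) (or_intror eq_refl)); intros.
  apply Rabs_le; lra.
Qed.

Lemma is_derive_sum_f_R0 (f df : nat -> R -> R) (N : nat) (x : R) :
  (forall m, is_derive (f m) x (df m x)) ->
  is_derive (fun t => sum_f_R0 (fun m => f m t) N) x (sum_f_R0 (fun m => df m x) N).
Proof.
  intros H. induction N as [|N IH]; simpl; [apply H|].
  apply (is_derive_plus (V := R_NormedModule)); [exact IH | apply H].
Qed.

(* Indexed from [m = 0], as series are in Coquelicot. *)
Definition freq (m : nat) : R := 2 * PI * INR (S m).

Definition dirichlet (N : nat) (x : R) : R :=
  1 + 2 * sum_f_R0 (fun m => cos (freq m * x)) N.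

(* [dirichlet_prim N 0 = - 1 / 2] is chosen so that it is odd about [1 / 2]; on (0, 1) it tends to 0. *)
Definition dirichlet_prim (N : nat) (x : R) : R :=
  x - / 2 + sum_f_R0 (fun m => 2 * sin (freq m * x) / freq m) N.

(** On [0, 1] the full series sums to [(x - x * x) / 2], so this is, up to sign, the tail of a
    Fourier series. Taking [1 - cos] instead of [- cos] fixes the constant of integration so that it
    vanishes at 0 and 1. *)
Definition dirichlet_prim2 (N : nat) (x : R) : R :=
  (x * x - x) / 2 + sum_f_R0 (fun m => 2 * (1 - cos (freq m * x)) / (freq m * freq m)) N.

Lemma freq_pos m : 0 < freq m.
Proof.
  unfold freq. pose proof PI_RGT_0. pose proof (lt_0_INR (S m) ltac:(lia)).
  apply Rmult_lt_0_compat; lra.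
Qed.

Lemma is_derive_dirichlet_prim N x : is_derive (dirichlet_prim N) x (dirichlet N x).
Proof.
  unfold dirichlet_prim, dirichlet.
  apply (is_derive_plus (V := R_NormedModule)).
  - auto_derive; [trivial|ring].
  - rewrite scal_sum.
    apply (is_derive_sum_f_R0 _ (fun m x => cos (freq m * x) * 2)).
    intros m. pose proof (freq_pos m). auto_derive; [lra|field; lra].
Qed.

Lemma is_derive_dirichlet_prim2 N x : is_derive (dirichlet_prim2 N) x (dirichlet_prim N x).
Proof.
  unfold dirichlet_prim, dirichlet_prim2.
  apply (is_derive_plus (V := R_NormedModule)).
  - auto_derive; [trivial|field].
  - apply (is_derive_sum_f_R0 _ (fun m x => 2 * sin (freq m * x) / freq m)).
    intros m. pose proof (freq_pos m). auto_derive; [nra|field; lra].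
Qed.

(** The last frequency is [2 PI (N + 1)], whence [2 N + 3] instead of the usual [2 N + 1]. *)
Lemma dirichlet_mult_sin N x :
  dirichlet N x * sin (PI * x) = sin ((2 * INR N + 3) * (PI * x)).
Proof.
  unfold dirichlet. induction N as [|N IH].
  - simpl sum_f_R0. unfold freq. simpl INR.
    replace (2 * PI * 1 * x) with (2 * (PI * x)) by ring.
    replace ((2 * 0 + 3) * (PI * x)) with (2 * (PI * x) + PI * x) by ring.
    rewrite sin_plus, sin_2a, cos_2a.
    pose proof (sin2_cos2 (PI * x)) as H. unfold Rsqr in H.
    replace (cos (PI * x) * cos (PI * x)) with (1 - sin (PI * x) * sin (PI * x)) by lra.
    replace (2 * sin (PI * x) * cos (PI * x) * cos (PI * x))
      with (2 * sin (PI * x) * (cos (PI * x) * cos (PI * x))) by ring.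
    replace (cos (PI * x) * cos (PI * x)) with (1 - sin (PI * x) * sin (PI * x)) by lra.
    ring.
  - rewrite tech5.
    replace ((1 + 2 * (sum_f_R0 (fun m => cos (freq m * x)) N + cos (freq (S N) * x))) * sin (PI * x))
      with ((1 + 2 * sum_f_R0 (fun m => cos (freq m * x)) N) * sin (PI * x)
            + 2 * cos (freq (S N) * x) * sin (PI * x)) by ring.
    rewrite IH.
    replace ((2 * INR N + 3) * (PI * x)) with (freq (S N) * x - PI * x)
      by (unfold freq; rewrite !S_INR; ring).
    replace ((2 * INR (S N) + 3) * (PI * x)) with (freq (S N) * x + PI * x)
      by (unfold freq; rewrite !S_INR; ring).
    rewrite sin_minus, sin_plus. ring.
Qed.

(** The degree 7 Taylor lower bound suffices. The range up to 2 contains [PI x] for [x <= 1 / 2] by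
    the crude bound [PI <= 4]. *)
Lemma sin_ge_third y : 0 <= y <= 2 -> y / 3 <= sin y.
Proof.
  intros Hy. pose proof PI2_3_2.
  destruct (SIN y) as [Hs _]; try lra.
  unfold sin_lb, sin_approx, sin_term in Hs. simpl in Hs.
  assert (Hs' : y - y ^ 3 / 6 + y ^ 5 / 120 - y ^ 7 / 5040 <= sin y).
  { eapply Rle_trans; [right|exact Hs]. field. }
  assert (0 <= y * y <= 4) by nra.
  assert (0 <= y ^ 3) by (apply pow_le; lra).
  assert (0 <= y ^ 5) by (apply pow_le; lra).
  replace (y ^ 7) with (y ^ 5 * (y * y)) in Hs' by ring.
  replace (y ^ 3) with (y * (y * y)) in * by ring.
  assert (y ^ 5 * (y * y) <= y ^ 5 * 4) by (apply Rmult_le_compat_l; lra).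
  nra.
Qed.

Lemma sin_INR_PI k : sin (INR k * PI) = 0.
Proof. apply sin_eq_0_1. exists (Z.of_nat k). now rewrite <- INR_IZR_INZ. Qed.

Lemma dirichlet_prim_half N : dirichlet_prim N (/ 2) = 0.
Proof.
  unfold dirichlet_prim. rewrite sum_eq_R0; [lra|].
  intros m _. replace (freq m * / 2) with (INR (S m) * PI) by (unfold freq; field).
  rewrite sin_INR_PI. unfold Rdiv. ring.
Qed.

Lemma cos_odd_half_PI N : cos ((2 * INR N + 3) * (PI * / 2)) = 0.
Proof.
  replace ((2 * INR N + 3) * (PI * / 2)) with (PI / 2 + INR (S N) * PI)
    by (rewrite S_INR; field).
  rewrite cos_plus, cos_PI2, sin_INR_PI. ring.
Qed.

(* Integrating [sin ((2 N + 3) PI x) / sin (PI x)] by parts once from [1 / 2] yields the decay in [N]. *)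
Lemma dirichlet_prim_decay N x :
  0 < x <= / 2 -> Rabs (dirichlet_prim N x) <= / ((2 * INR N + 3) * x).
Proof.
  intros Hx. set (k := 2 * INR N + 3).
  assert (Hk : 3 <= k) by (unfold k; pose proof (pos_INR N); lra).
  pose proof PI_RGT_0 as HPI. pose proof PI2_3_2. pose proof PI_4.
  assert (Hsin : forall t, x <= t <= / 2 -> 0 < sin (PI * t)).
  { intros t Ht. apply sin_gt_0; nra. }
  assert (Hcos : forall t, x <= t <= / 2 -> 0 <= cos (PI * t)).
  { intros t Ht. apply cos_ge_0; nra. }
  (* The added quotient is the boundary term of the integration by parts. The derivative that
     remains is dominated by that of [- 1 / (k PI sin (PI t))], because [cos (PI t) >= 0] up to
     [1 / 2]. *)
  pose proof (dominated_increment
    (fun t => dirichlet_prim N t + cos (k * (PI * t)) / (k * PI * sin (PI * t)))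
    (fun t => - / (k * PI * sin (PI * t)))
    (fun t => - cos (k * (PI * t)) * cos (PI * t) / (k * (sin (PI * t) * sin (PI * t))))
    (fun t => cos (PI * t) / (k * (sin (PI * t) * sin (PI * t))))
    x (/ 2) ltac:(lra)) as H1.
  lapply H1; clear H1; [intros H1 | ].
  2:{ intros t Ht. specialize (Hsin t Ht).
      assert (Hd : dirichlet N t = sin (k * (PI * t)) / sin (PI * t)).
      { unfold k. rewrite <- dirichlet_mult_sin. field. lra. }
      evar_last.
      apply (is_derive_plus (V := R_NormedModule)).
      apply is_derive_dirichlet_prim.
      auto_derive; [|reflexivity].
      apply Rmult_integral_contrapositive; split; nra.
      change plus with Rplus. rewrite Hd. field. repeat split; lra. }
  lapply H1; clear H1; [intros H1 | ].
  2:{ intros t Ht. specialize (Hsin t Ht). auto_derive.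
      apply Rmult_integral_contrapositive; split; nra.
      field. repeat split; lra. }
  lapply H1; clear H1; [intros H1 | ].
  2:{ intros t Ht. specialize (Hsin t Ht). specialize (Hcos t Ht).
      unfold Rdiv. rewrite Rabs_mult, Rabs_mult, Rabs_Ropp.
      assert (0 < / (k * (sin (PI * t) * sin (PI * t)))).
      { apply Rinv_0_lt_compat. apply Rmult_lt_0_compat; nra. }
      rewrite (Rabs_pos_eq (/ _)) by lra.
      apply Rmult_le_compat_r; [lra|].
      rewrite (Rabs_pos_eq (cos (PI * t))) by lra.
      rewrite <- (Rmult_1_l (cos (PI * t))) at 2.
      apply Rmult_le_compat_r; [lra|]. apply Rabs_le. apply COS_bound. }
  rewrite dirichlet_prim_half in H1. unfold k in H1 at 1. rewrite cos_odd_half_PI in H1.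
  replace (PI * / 2) with (PI / 2) in H1 by reflexivity. rewrite sin_PI2 in H1.
  specialize (Hsin x ltac:(lra)).
  assert (Hs2 : x * PI / 3 <= sin (PI * x)).
  { pose proof (sin_ge_third (PI * x)). lapply H2; [lra|]. split; nra. }
  (* As [PI > 3], [PI sin (PI x) >= PI^2 x / 3 >= 2 x]. The boundary term and the remaining integral
     each take half of the final bound [1 / (k x)]. *)
  assert (Hi : / (k * PI * sin (PI * x)) <= / 2 * / (k * x)).
  { rewrite <- Rinv_mult. apply Rinv_le_contravar.
    - apply Rmult_lt_0_compat; [lra|]. nra.
    - assert (x * 2 <= PI * sin (PI * x)) by nra. nra. }
  assert (Hkp : 0 < / (k * PI * 1)) by (apply Rinv_0_lt_compat; nra).
  assert (Hc : Rabs (cos (k * (PI * x)) / (k * PI * sin (PI * x))) <= / (k * PI * sin (PI * x))).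
  { unfold Rdiv. rewrite Rabs_mult.
    assert (0 < / (k * PI * sin (PI * x))).
    { apply Rinv_0_lt_compat. apply Rmult_lt_0_compat; nra. }
    rewrite (Rabs_pos_eq (/ _)) by lra.
    rewrite <- (Rmult_1_l (/ _)) at 2. apply Rmult_le_compat_r; [lra|].
    apply Rabs_le, COS_bound. }
  apply Rabs_le_between in Hc. apply Rabs_le_between in H1.
  unfold Rdiv in *. rewrite Rmult_0_l in H1.
  apply Rabs_le. lra.
Qed.

Lemma abs_sin_le y : 0 <= y -> Rabs (sin y) <= y.
Proof.
  intros Hy.
  pose proof (dominated_increment sin (fun t => t) cos (fun _ => 1) 0 y Hy) as H.
  rewrite sin_0, !Rminus_0_r in H. apply H; intros.
  - auto_derive; [trivial|ring].
  - auto_derive; [trivial|ring].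
  - apply Rabs_le, COS_bound.
Qed.

(** The decay estimate is useless near 0. While [(2 N + 3) x <= 1], however, each of the [N + 1]
    terms is at most [2 x], so the sum stays below 1; beyond that point the decay estimate is itself
    at most 1. *)
Lemma dirichlet_prim_bound N x : 0 <= x <= / 2 -> Rabs (dirichlet_prim N x) <= 2.
Proof.
  intros Hx. pose proof (pos_INR N) as HN.
  destruct (Rle_lt_dec ((2 * INR N + 3) * x) 1) as [H|H].
  - assert (Hs : Rabs (sum_f_R0 (fun m => 2 * sin (freq m * x) / freq m) N)
                 <= (INR N + 1) * (2 * x)).
    { eapply Rle_trans; [apply Rabs_triang_gen|].
      rewrite <- S_INR, Rmult_comm, <- sum_cte. apply sum_Rle. intros m _.
      pose proof (freq_pos m).
      unfold Rdiv. rewrite !Rabs_mult, (Rabs_pos_eq 2), (Rabs_pos_eq (/ _)) by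
        (try apply Rlt_le, Rinv_0_lt_compat; lra).
      apply Rle_div_l with (c := freq m); [lra|].
      pose proof (abs_sin_le (freq m * x)). nra. }
    unfold dirichlet_prim.
    apply Rabs_le_between in Hs. apply Rabs_le. lra.
  - eapply Rle_trans; [apply dirichlet_prim_decay; nra|].
    apply Rle_trans with (/ 1); [apply Rinv_le_contravar|]; lra.
Qed.

Lemma dirichlet_prim2_0 N : dirichlet_prim2 N 0 = 0.
Proof.
  unfold dirichlet_prim2. rewrite sum_eq_R0; [lra|].
  intros m _. rewrite Rmult_0_r, cos_0. unfold Rdiv. ring.
Qed.

Lemma freq_period m k x : freq m * (x + INR k) = freq m * x + 2 * INR (S m * k) * PI.
Proof. unfold freq. rewrite mult_INR. ring. Qed.

Lemma dirichlet_prim2_sym N x : dirichlet_prim2 N (1 - x) = dirichlet_prim2 N x.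
Proof.
  unfold dirichlet_prim2. f_equal; [field|].
  apply sum_eq. intros m _. do 3 f_equal.
  replace (1 - x) with (- x + INR 1) by (simpl; ring).
  rewrite freq_period, cos_period, <- cos_neg. f_equal. ring.
Qed.

(** Integrate [dirichlet_prim] from 0: the uniform bound 2 costs [2 d] on [[0, d]], and the decay
    estimate at [d] controls the rest. The cut [d] is left free, to be fixed before [N]. *)
Lemma dirichlet_prim2_bound N d x :
  0 < d <= / 2 -> 0 <= x <= / 2 ->
  Rabs (dirichlet_prim2 N x) <= 2 * d + / ((2 * INR N + 3) * d).
Proof.
  intros Hd Hx. pose proof (pos_INR N) as HN.
  assert (Hk : 0 < (2 * INR N + 3) * d) by nra.
  assert (Hk' : 0 < / ((2 * INR N + 3) * d)) by now apply Rinv_0_lt_compat.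
  assert (H1 : forall y, 0 <= y <= / 2 -> y <= d -> Rabs (dirichlet_prim2 N y) <= 2 * d).
  { intros y Hy Hyd.
    pose proof (dominated_increment (dirichlet_prim2 N) (fun t => 2 * t)
      (dirichlet_prim N) (fun _ => 2) 0 y (proj1 Hy)) as H.
    rewrite dirichlet_prim2_0, Rminus_0_r in H.
    eapply Rle_trans; [apply H|lra]; intros.
    - apply is_derive_dirichlet_prim2.
    - auto_derive; [trivial|ring].
    - apply dirichlet_prim_bound; lra. }
  destruct (Rle_lt_dec x d) as [Hxd|Hxd]; [specialize (H1 x Hx Hxd); lra|].
  pose proof (dominated_increment (dirichlet_prim2 N) (fun t => / ((2 * INR N + 3) * d) * t)
      (dirichlet_prim N) (fun _ => / ((2 * INR N + 3) * d)) d x ltac:(lra)) as H.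
  specialize (H1 d ltac:(lra) ltac:(lra)).
  replace (dirichlet_prim2 N x) with
    (dirichlet_prim2 N d + (dirichlet_prim2 N x - dirichlet_prim2 N d)) by ring.
  eapply Rle_trans; [apply Rabs_triang|].
  apply Rplus_le_compat; [exact H1|].
  eapply Rle_trans; [apply H|nra]; intros.
  - apply is_derive_dirichlet_prim2.
  - auto_derive; [trivial|ring].
  - eapply Rle_trans; [apply dirichlet_prim_decay; lra|].
    apply Rinv_le_contravar; nra.
Qed.

Lemma dirichlet_prim2_unif_cvg (eps : posreal) :
  eventually (fun N => forall x, 0 <= x <= 1 -> Rabs (dirichlet_prim2 N x) <= eps).
Proof.
  set (d := Rmin (/ 2) (eps / 4)).
  assert (Hd : 0 < d <= / 2 /\ d <= eps / 4).
  { unfold d. pose proof (cond_pos eps).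
    pose proof (Rmin_l (/ 2) (eps / 4)). pose proof (Rmin_r (/ 2) (eps / 4)).
    repeat split; try lra. apply Rmin_glb_lt; lra. }
  destruct (INR_unbounded (2 / (eps * d))) as [N0 HN0].
  exists N0. intros N HN.
  assert (HNr : INR N0 <= INR N) by now apply le_INR.
  pose proof (cond_pos eps) as He. pose proof (pos_INR N).
  assert (Hk : / ((2 * INR N + 3) * d) <= eps / 2).
  { apply Rle_trans with (/ (2 / eps)); [|right; field; lra].
    apply Rinv_le_contravar; [apply Rdiv_lt_0_compat; lra|].
    replace (2 / eps) with (2 / (eps * d) * d) by (field; lra).
    apply Rmult_le_compat_r; lra. }
  assert (Hhalf : forall x, 0 <= x <= / 2 -> Rabs (dirichlet_prim2 N x) <= eps).
  { intros x Hx. eapply Rle_trans; [apply (dirichlet_prim2_bound N d); lra|]. lra. }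
  intros x Hx. destruct (Rle_lt_dec x (/ 2)).
  - apply Hhalf; lra.
  - rewrite <- dirichlet_prim2_sym. apply Hhalf; lra.
Qed.

(** * Poisson summation on the half-line *)

(** Absolute convergence of an improper integral in terms of primitives: [W] is a primitive of a
    majorant of the derivative of [F], and the Cauchy criterion passes from [W] to [F]. *)
Lemma dominated_is_lim (F W : R -> R) (Wl : R) :
  (forall a b, a <= b -> Rabs (F b - F a) <= W b - W a) ->
  is_lim W p_infty Wl ->
  exists l : R, is_lim F p_infty l.
Proof.
  intros HFW HW.
  destruct (proj1 (filterlim_locally_cauchy (F := Rbar_locally' p_infty) F)) as [l Hl];
    [|exists l; exact Hl].
  intros eps.
  destruct (proj2 (filterlim_locally_cauchy (F := Rbar_locally' p_infty) W)
    (ex_intro _ Wl HW) eps) as [P [HP HPW]].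
  exists P. split; [exact HP|]. intros u v Hu Hv.
  assert (HuvW : Rabs (W v - W u) < eps) by exact (HPW u v Hu Hv).
  change (Rabs (F v - F u) < eps).
  destruct (Rle_lt_dec u v) as [H|H].
  - specialize (HFW u v H). apply Rabs_lt_between in HuvW. lra.
  - specialize (HFW v u ltac:(lra)). rewrite Rabs_minus_sym.
    apply Rabs_lt_between in HuvW. lra.
Qed.

Lemma is_lim_mult_bounded (f g : R -> R) :
  is_lim f p_infty 0 -> (forall x, Rabs (g x) <= 1) -> is_lim (fun x => f x * g x) p_infty 0.
Proof.
  intros Hf Hg. apply is_lim_spec. apply is_lim_spec in Hf. intros eps.
  destruct (Hf eps) as [M HM]. exists M. intros x Hx. specialize (HM x Hx).
  rewrite Rminus_0_r in *. rewrite Rabs_mult. specialize (Hg x).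
  pose proof (Rabs_pos (f x)). pose proof (Rabs_pos (g x)). nra.
Qed.

Lemma dirichlet_period N k x : dirichlet N (x - INR k) = dirichlet N x.
Proof.
  unfold dirichlet. do 2 f_equal. apply sum_eq. intros m _.
  rewrite <- (cos_period _ (S m * k)), <- freq_period. do 2 f_equal. ring.
Qed.

Lemma is_lim_seq_comp_INR (f : R -> R) (l : Rbar) :
  is_lim f p_infty l -> is_lim_seq (fun n => f (INR n)) l.
Proof.
  intros H. apply (is_lim_comp_seq f INR p_infty l H); [|apply is_lim_seq_INR].
  exists O. intros n _. discriminate.
Qed.

Lemma is_derive_parts (F S f f1 g h : R -> R) (dF dS df df1 dg dh K x : R) :
  is_derive F x dF -> is_derive S x dS -> is_derive f x df -> is_derive f1 x df1 ->
  is_derive g (x - K) dg -> is_derive h (x - K) dh ->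
  is_derive (fun t => F t + 2 * S t - (f t * g (t - K) - f1 t * h (t - K))) x
    (dF + 2 * dS - (df * g (x - K) + f x * dg - (df1 * h (x - K) + f1 x * dh))).
Proof.
  intros H0 H1 H2 H3 H4 H5. auto_derive.
  - repeat split; eexists; eassumption.
  - replace (x + - K) with (x - K) by ring.
    rewrite (is_derive_unique (fun x : R => F x) _ _ H0),
      (is_derive_unique (fun x : R => S x) _ _ H1), (is_derive_unique (fun x : R => f x) _ _ H2),
      (is_derive_unique (fun x : R => f1 x) _ _ H3), (is_derive_unique (fun x : R => g x) _ _ H4),
      (is_derive_unique (fun x : R => h x) _ _ H5). ring.
Qed.

Section EulerMaclaurin.

Variables (F f f1 f2 W w : R -> R) (Wl : R).
Hypothesis HF : forall x : R, is_derive F x (f x).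
Hypothesis Hf : forall x : R, is_derive f x (f1 x).
Hypothesis Hf1 : forall x : R, is_derive f1 x (f2 x).
Hypothesis HW : forall x : R, is_derive W x (w x).
Hypothesis Hw : forall x : R, Rabs (f2 x) <= w x.
Hypothesis HWl : is_lim W p_infty Wl.
Hypothesis Hf0 : is_lim f p_infty 0.
Hypothesis Hf10 : is_lim f1 p_infty 0.

Definition cos_int (m : nat) (b : R) : R := RInt (fun x => f x * cos (freq m * x)) 0 b.

Lemma cos_int_continuous m x : continuous (fun x => f x * cos (freq m * x)) x.
Proof.
  apply (continuous_mult (K := R_AbsRing)).
  - apply (ex_derive_continuous (V := R_NormedModule)). eexists; apply Hf.
  - apply (ex_derive_continuous (V := R_NormedModule)). auto_derive; trivial.
Qed.

Lemma is_RInt_cos_int m b : is_RInt (fun x => f x * cos (freq m * x)) 0 b (cos_int m b).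
Proof.
  apply (RInt_correct (V := R_CompleteNormedModule)), ex_RInt_continuous. intros; apply cos_int_continuous.
Qed.

Lemma is_derive_cos_int m x : is_derive (cos_int m) x (f x * cos (freq m * x)).
Proof.
  apply (is_derive_RInt (fun x => f x * cos (freq m * x)) (cos_int m) 0 x); [|apply cos_int_continuous].
  exists (mkposreal 1 Rlt_0_1). intros y _. apply is_RInt_cos_int.
Qed.

Lemma W_increasing a b : a <= b -> 0 <= W b - W a.
Proof.
  intros Hab. eapply Rle_trans; [apply Rabs_pos|].
  apply (dominated_increment f1 W f2 w); auto.
Qed.

(** Two integrations by parts turn the conditionally convergent integral into one of
    [- f2 cos (o x) / o^2], which is dominated by [W / o^2]; the boundary terms vanish at infinity
    with [f] and [f1]. *)
Lemma cos_int_cvg m : exists l : R, is_lim (cos_int m) p_infty l.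
Proof.
  pose proof (freq_pos m) as Hm. set (o := freq m) in *.
  destruct (dominated_is_lim
    (fun x => cos_int m x - (f x * sin (o * x) * / o + f1 x * cos (o * x) * / (o * o)))
    (fun x => W x * / (o * o)) (Wl * / (o * o))) as [l Hl].
  - intros a b Hab.
    apply (dominated_increment
     (fun x => cos_int m x - (f x * sin (o * x) * / o + f1 x * cos (o * x) * / (o * o)))
     (fun x => W x * / (o * o)) (fun x => - (f2 x * cos (o * x) * / (o * o)))
      (fun x => w x * / (o * o)) a b Hab).
    + intros x _. pose proof (is_derive_cos_int m x) as H0. fold o in H0.
      pose proof (Hf x) as H1. pose proof (Hf1 x) as H2.
      auto_derive.
      * repeat split; eexists; eassumption.
      * rewrite (is_derive_unique (fun x : R => cos_int m x) _ _ H0).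
        rewrite (is_derive_unique (fun x : R => f x) _ _ H1), (is_derive_unique (fun x : R => f1 x) _ _ H2).
        field. lra.
    + intros x _. pose proof (HW x) as H0.
      auto_derive; [eexists; eassumption|].
      rewrite (is_derive_unique (fun x : R => W x) _ _ H0). ring.
    + intros x _. rewrite Rabs_Ropp, !Rabs_mult.
      assert (0 < / (o * o)) by (apply Rinv_0_lt_compat; nra).
      rewrite (Rabs_pos_eq (/ _)) by lra.
      apply Rmult_le_compat_r; [lra|].
      pose proof (Hw x). pose proof (Rabs_pos (f2 x)).
      assert (Rabs (cos (o * x)) <= 1) by apply Rabs_le, COS_bound.
      pose proof (Rabs_pos (cos (o * x))). nra.
  - apply (is_lim_scal_r W (/ (o * o)) p_infty Wl HWl).
  - exists l.
    apply is_lim_ext with (fun x =>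
      (cos_int m x - (f x * sin (o * x) * / o + f1 x * cos (o * x) * / (o * o)))
      + (f x * sin (o * x) * / o + f1 x * cos (o * x) * / (o * o))); [intros; ring|].
    replace (Finite l) with (Finite (l + (0 * / o + 0 * / (o * o)))) by (f_equal; ring).
    apply is_lim_plus'; [exact Hl|]. apply is_lim_plus'.
    + apply (is_lim_scal_r _ (/ o) p_infty 0). apply is_lim_mult_bounded; [exact Hf0|].
      intros. apply Rabs_le, SIN_bound.
    + apply (is_lim_scal_r _ (/ (o * o)) p_infty 0). apply is_lim_mult_bounded; [exact Hf10|].
      intros. apply Rabs_le, COS_bound.
Qed.

(** The error of the trapezoidal rule with unit step on [[0, n]]. *)
Definition em_error (n : nat) : R :=
  sum_f_R0 (fun k => f (INR k)) n - (F (INR n) - F 0) - f 0 / 2 - f (INR n) / 2.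

Lemma dirichlet_prim2_1 N : dirichlet_prim2 N 1 = 0.
Proof. rewrite <- (dirichlet_prim2_0 N), <- (dirichlet_prim2_sym N 0). f_equal. ring. Qed.

(** The values [- 1 / 2] at 0 and [1 / 2] at 1 make the boundary term on [[k, k + 1]] equal to
    [(f k + f (k + 1)) / 2], a step of the trapezoidal rule. *)
Lemma dirichlet_prim_0 N : dirichlet_prim N 0 = - / 2.
Proof.
  unfold dirichlet_prim. rewrite sum_eq_R0; [lra|].
  intros m _. rewrite Rmult_0_r, sin_0. unfold Rdiv. ring.
Qed.

Lemma dirichlet_prim_1 N : dirichlet_prim N 1 = / 2.
Proof.
  unfold dirichlet_prim. rewrite sum_eq_R0; [lra|].
  intros m _. replace (freq m * 1) with (2 * INR (S m) * PI) by (unfold freq; ring).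
  replace (2 * INR (S m) * PI) with (INR (2 * S m) * PI) by (rewrite mult_INR; simpl (INR 2); ring).
  rewrite sin_INR_PI. unfold Rdiv. ring.
Qed.

(* Two integrations by parts: [(f H - f1 G)' = f D - f2 G] with [G'' = H' = D] the Dirichlet kernel
   and [G] vanishing at the integers. *)
Lemma fourier_sum_step N e k :
  (forall x, 0 <= x <= 1 -> Rabs (dirichlet_prim2 N x) <= e) ->
  Rabs (F (INR (S k)) + 2 * sum_f_R0 (fun m => cos_int m (INR (S k))) N
        - (F (INR k) + 2 * sum_f_R0 (fun m => cos_int m (INR k)) N)
        - (f (INR k) + f (INR (S k))) / 2) <= e * W (INR (S k)) - e * W (INR k).
Proof.
  intros He. set (K := INR k).
  pose proof (dominated_increment
    (fun x => F x + 2 * sum_f_R0 (fun m => cos_int m x) N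
       - (f x * dirichlet_prim N (x - K) - f1 x * dirichlet_prim2 N (x - K)))
    (fun x => e * W x) (fun x => f2 x * dirichlet_prim2 N (x - K)) (fun x => e * w x)
    K (INR (S k))) as H. rewrite S_INR in *. fold K in H |- *.
  replace (K + 1 - K) with 1 in H by ring. rewrite Rminus_diag in H.
  rewrite dirichlet_prim_0, dirichlet_prim_1, dirichlet_prim2_0, dirichlet_prim2_1 in H.
  eapply Rle_trans; [right|apply H]; [f_equal; field|lra| | |].
  - intros x _.
    assert (Hs : is_derive (fun x => sum_f_R0 (fun m => cos_int m x) N) x
                (sum_f_R0 (fun m => f x * cos (freq m * x)) N)).
    { apply (is_derive_sum_f_R0 cos_int (fun m x => f x * cos (freq m * x))).
      intros m. apply is_derive_cos_int. }
    pose proof (HF x) as H0. pose proof (Hf x) as H1. pose proof (Hf1 x) as H2.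
    pose proof (is_derive_dirichlet_prim N (x - K)) as H3.
    pose proof (is_derive_dirichlet_prim2 N (x - K)) as H4.
    evar_last; [apply (is_derive_parts F _ f f1 _ _ _ _ _ _ _ _ K x H0 Hs H1 H2 H3 H4)|].
      unfold K. rewrite dirichlet_period. unfold dirichlet.
      replace (sum_f_R0 (fun m => f x * cos (freq m * x)) N)
        with (f x * sum_f_R0 (fun m => cos (freq m * x)) N); [ring|].
      rewrite scal_sum. apply sum_eq. intros; ring.
  - intros x _. apply is_derive_scal, HW.
  - intros x Hx. rewrite Rabs_mult, Rmult_comm.
    apply Rmult_le_compat; try apply Rabs_pos; [apply He; lra|apply Hw].
Qed.

Lemma em_error_fourier N e n :
  (forall x, 0 <= x <= 1 -> Rabs (dirichlet_prim2 N x) <= e) ->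
  Rabs (2 * sum_f_R0 (fun m => cos_int m (INR n)) N - em_error n) <= e * W (INR n) - e * W 0.
Proof.
  intros He. induction n as [|n IH].
  - unfold em_error. simpl. rewrite sum_eq_R0.
    + right. replace (_ - _) with 0 by field. rewrite Rabs_R0. ring.
    + intros m _. unfold cos_int. rewrite RInt_point. reflexivity.
  - pose proof (fourier_sum_step N e n He) as Hstep.
    unfold em_error in *. rewrite tech5.
    apply Rabs_le_between in Hstep. apply Rabs_le_between in IH.
    apply Rabs_le. lra.
Qed.

(* [em_error_fourier] is uniform in [n], so the limits over [n] and over [N] can be exchanged. *)
Lemma fourier_summation :
  exists (J : nat -> R) (L : R),
    (forall m, is_lim (fun b => RInt (fun x => f x * cos (freq m * x)) 0 b) p_infty (J m)) /\
    is_lim_seq (fun n => sum_f_R0 (fun k => f (INR k)) n - (F (INR n) - F 0)) L /\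
    is_series J ((L - f 0 / 2) / 2).
Proof.
  assert (HJ : exists J : nat -> R, forall m, is_lim (cos_int m) p_infty (J m)).
  { exists (fun m => real (Lim (cos_int m) p_infty)). intros m.
    destruct (cos_int_cvg m) as [l Hl]. rewrite (is_lim_unique _ _ _ Hl). exact Hl. }
  destruct HJ as [J HJ].
  assert (HWn : is_lim_seq (fun n => W (INR n)) Wl) by now apply is_lim_seq_comp_INR.
  assert (HWb : forall n, W (INR n) - W 0 <= Wl - W 0).
  { intros n. apply Rplus_le_compat_r.
    apply (is_lim_seq_incr_compare (fun n => W (INR n)) Wl HWn).
    intros k. pose proof (W_increasing (INR k) (INR (S k))). rewrite S_INR in *. lra. }
  pose proof (HWb O) as HWb0. simpl in HWb0.
  (* The [+ 1] keeps [V] positive even if [W] is constant. *)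
  set (V := Wl - W 0 + 1).
  assert (HV : 0 < V) by (unfold V; lra).
  assert (Hsmall : forall eps : posreal, eventually (fun N => forall n,
     Rabs (2 * sum_f_R0 (fun m => cos_int m (INR n)) N - em_error n) <= eps)).
  { intros eps.
    assert (He : 0 < eps / V) by (apply Rdiv_lt_0_compat; [apply cond_pos|lra]).
    destruct (dirichlet_prim2_unif_cvg (mkposreal _ He)) as [N0 HN0].
    exists N0. intros N HN n. specialize (HN0 N HN). simpl in HN0.
    eapply Rle_trans; [apply (em_error_fourier N _ n HN0)|].
    rewrite <- Rmult_minus_distr_l.
    apply Rle_trans with (eps / V * V); [|right; field; lra].
    apply Rmult_le_compat_l; [lra|]. specialize (HWb n). unfold V. lra. }
  assert (HS : forall N, is_lim_seq (fun n => 2 * sum_f_R0 (fun m => cos_int m (INR n)) N)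
                 (2 * sum_f_R0 J N)).
  { intros N. apply (is_lim_seq_scal_l _ 2 (sum_f_R0 J N)). induction N as [|N IH]; simpl.
    - apply (is_lim_seq_comp_INR (cos_int 0)), HJ.
    - apply is_lim_seq_plus'; [exact IH|]. apply (is_lim_seq_comp_INR (cos_int (S N))), HJ. }
  (* One fixed [N] is enough: [em_error] stays within [eps / 3] of a convergent sequence, so it is
     Cauchy. *)
  assert (HE : ex_finite_lim_seq em_error).
  { apply ex_lim_seq_cauchy_corr. intros eps.
    assert (He : 0 < eps / 3) by (pose proof (cond_pos eps); lra).
    destruct (Hsmall (mkposreal _ He)) as [N HN]. specialize (HN N (le_n _)). simpl in HN.
    destruct (proj1 (ex_lim_seq_cauchy_corr _) (ex_intro _ (2 * sum_f_R0 J N) (HS N)) (mkposreal _ He)) as [n0 Hn0].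
    exists n0. intros n p Hn Hp. specialize (Hn0 n p Hn Hp). simpl in Hn0.
    pose proof (HN n) as H1. pose proof (HN p) as H2.
    apply Rabs_le_between in H1. apply Rabs_le_between in H2. apply Rabs_lt_between in Hn0.
    apply Rabs_def1; lra. }
  destruct HE as [E HE].
  (* Of the two half-weights of the trapezoidal rule, [f n / 2] tends to 0 and [f 0 / 2] stays. *)
  exists J, (E + f 0 / 2). split; [exact HJ|]. split.
  - apply is_lim_seq_ext with (fun n => em_error n + f 0 / 2 + f (INR n) / 2).
    { intros n. unfold em_error. ring. }
    replace (Finite (E + f 0 / 2)) with (Finite (E + f 0 / 2 + 0 / 2)) by (f_equal; field).
    apply is_lim_seq_plus'; [apply is_lim_seq_plus'; [exact HE|apply is_lim_seq_const]|].
    apply (is_lim_seq_scal_r (fun n => f (INR n)) (/ 2) 0). now apply is_lim_seq_comp_INR.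
  - replace ((E + f 0 / 2 - f 0 / 2) / 2) with (E / 2) by field.
    apply (is_lim_seq_spec (sum_n J) (E / 2)). intros eps.
    destruct (Hsmall eps) as [N0 HN0]. exists N0. intros N HN. specialize (HN0 N HN).
    rewrite sum_n_Reals.
    assert (H : Rabs (2 * sum_f_R0 J N - E) <= eps).
    { apply (is_lim_seq_le _ _ (Rabs (2 * sum_f_R0 J N - E)) eps HN0); [|apply is_lim_seq_const].
      apply (is_lim_seq_abs _ (2 * sum_f_R0 J N - E)). apply is_lim_seq_minus'; [apply HS|exact HE]. }
    pose proof (cond_pos eps).
    apply Rabs_le_between in H. apply Rabs_def1; lra.
Qed.

End EulerMaclaurin.

(** * Complex exponentials, limits and products *)

Lemma Cmod_le_abs (x y : R) : Cmod (x, y) <= Rabs x + Rabs y.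
Proof.
  replace (x, y) with (Cplus (RtoC x) (Cmult Ci (RtoC y))) by (apply injective_projections; simpl; ring).
  eapply Rle_trans; [apply Cmod_triangle|].
  rewrite Cmod_mult, Cmod_Ci, !Cmod_R. lra.
Qed.

Lemma exp_le x y : x <= y -> exp x <= exp y.
Proof. intros [H| ->]; [now apply Rlt_le, exp_increasing|apply Rle_refl]. Qed.

Lemma exp_sub_1_le x : exp x - 1 <= x * exp x.
Proof.
  pose proof (exp_ineq1_le (- x)) as H. rewrite exp_Ropp in H. pose proof (exp_pos x).
  assert (H1 : (1 - x) * exp x <= / exp x * exp x) by (apply Rmult_le_compat_r; lra).
  rewrite Rinv_l in H1 by lra. lra.
Qed.

Lemma abs_exp_sub_1_le x : Rabs (exp x - 1) <= Rabs x * exp (Rabs x).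
Proof.
  pose proof (exp_ineq1_le x). pose proof (exp_sub_1_le x). pose proof (exp_pos x).
  destruct (Rle_lt_dec 0 x).
  - rewrite (Rabs_pos_eq x) by lra. apply Rabs_le. nra.
  - rewrite (Rabs_left x) by lra. pose proof (exp_ineq1_le (- x)). apply Rabs_le. nra.
Qed.

Lemma abs_exp_sub_1_sub_le x : Rabs (exp x - 1 - x) <= x ^ 2 * exp (Rabs x).
Proof.
  pose proof (exp_ineq1_le x). pose proof (exp_sub_1_le x).
  rewrite Rabs_pos_eq by lra.
  apply Rle_trans with (x * (exp x - 1)); [lra|].
  apply Rle_trans with (Rabs x * Rabs (exp x - 1)).
  - rewrite <- Rabs_mult. apply Rle_abs.
  - rewrite <- pow2_abs. pose proof (abs_exp_sub_1_le x). pose proof (Rabs_pos x). nra.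
Qed.

Lemma abs_cos_sub_1_le x : Rabs (cos x - 1) <= x ^ 2.
Proof.
  assert (H : forall y, 0 <= y -> Rabs (cos y - 1) <= y ^ 2).
  { intros y Hy.
    pose proof (dominated_increment cos (fun t => t ^ 2) (fun t => - sin t) (fun t => 2 * t) 0 y Hy) as H.
    rewrite cos_0 in H. eapply Rle_trans; [apply H|]; intros.
    - auto_derive; [trivial|ring].
    - auto_derive; [trivial|ring].
    - rewrite Rabs_Ropp. pose proof (abs_sin_le x0). lra.
    - simpl. lra. }
  destruct (Rle_lt_dec 0 x); [now apply H|].
  rewrite <- cos_neg. replace (x ^ 2) with ((- x) ^ 2) by ring. apply H. lra.
Qed.

Lemma abs_sin_sub_le x : Rabs (sin x - x) <= x ^ 2.
Proof.
  assert (H : forall y, 0 <= y -> Rabs (sin y - y) <= y ^ 2).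
  { intros y Hy.
    pose proof (dominated_increment (fun t => sin t - t) (fun t => t ^ 2) (fun t => cos t - 1) (fun t => 2 * t) 0 y Hy) as H.
    simpl in H. rewrite sin_0, !Rminus_0_r in H. eapply Rle_trans; [apply H|]; intros.
    - auto_derive; [trivial|ring].
    - auto_derive; [trivial|ring].
    - pose proof (abs_cos_sub_1_le x0). pose proof (COS_bound x0).
      apply Rabs_le_between in H1. apply Rabs_le.
      destruct (Rle_lt_dec x0 1); nra.
    - simpl. lra. }
  destruct (Rle_lt_dec 0 x); [now apply H|].
  replace (sin x - x) with (- (sin (- x) - - x)) by (rewrite sin_neg; ring).
  rewrite Rabs_Ropp. replace (x ^ 2) with ((- x) ^ 2) by ring. apply H. lra.
Qed.

Lemma Cexp_plus a b : Cexp (a + b) = (Cexp a * Cexp b)%C.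
Proof.
  unfold Cexp. destruct a as [a1 a2], b as [b1 b2]. simpl.
  rewrite exp_plus, cos_plus, sin_plus. apply injective_projections; simpl; ring.
Qed.

Lemma Cmod_Cexp z : Cmod (Cexp z) = exp (Re z).
Proof.
  unfold Cmod, Cexp. simpl fst. simpl snd.
  replace ((exp (Re z) * cos (Im z)) ^ 2 + (exp (Re z) * sin (Im z)) ^ 2)
    with (exp (Re z) * exp (Re z) * ((sin (Im z))² + (cos (Im z))²)) by (unfold Rsqr; ring).
  rewrite sin2_cos2, Rmult_1_r. apply sqrt_square, Rlt_le, exp_pos.
Qed.

Lemma Cmod_Cexp_le z : Cmod (Cexp z) <= exp (Cmod z).
Proof.
  rewrite Cmod_Cexp. apply exp_le.
  eapply Rle_trans; [apply Rle_abs|apply re_le_Cmod].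
Qed.

Lemma Cexp_RtoC x : Cexp (RtoC x) = RtoC (exp x).
Proof. unfold Cexp. simpl. rewrite cos_0, sin_0. apply injective_projections; simpl; ring. Qed.

Lemma Cexp_remainder w : Cmod (Cexp w - 1 - w) <= 4 * exp (Cmod w) * Cmod w ^ 2.
Proof.
  destruct w as [a b]. set (r := Cmod (a, b)).
  assert (Ha : Rabs a <= r) by apply (re_le_Cmod (a, b)).
  assert (Hr : r ^ 2 = a ^ 2 + b ^ 2) by apply (Cmod2_alt (a, b)).
  assert (Hr0 : 0 <= r) by apply Cmod_ge_0.
  assert (HE : exp (Rabs a) <= exp r) by now apply exp_le.
  assert (HE2 : exp a <= exp (Rabs a)) by apply exp_le, Rle_abs.
  pose proof (exp_pos a) as Hp. pose proof (exp_pos r).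
  replace (Cexp (a, b) - 1 - (a, b))%C
    with (exp a * (cos b - 1) + (exp a - 1 - a), exp a * (sin b - b) + (exp a - 1) * b)
    by (unfold Cexp; apply injective_projections; simpl; ring).
  eapply Rle_trans; [apply Cmod_le_abs|].
  pose proof (abs_cos_sub_1_le b). pose proof (abs_sin_sub_le b).
  pose proof (abs_exp_sub_1_le a). pose proof (abs_exp_sub_1_sub_le a).
  assert (H4 : Rabs (exp a * (cos b - 1)) <= exp r * b ^ 2).
  { rewrite Rabs_mult, (Rabs_pos_eq (exp a)) by lra. apply Rmult_le_compat; try lra. apply Rabs_pos. }
  assert (H5 : Rabs (exp a * (sin b - b)) <= exp r * b ^ 2).
  { rewrite Rabs_mult, (Rabs_pos_eq (exp a)) by lra. apply Rmult_le_compat; try lra. apply Rabs_pos. }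
  assert (H6 : Rabs (exp a - 1 - a) <= exp r * a ^ 2).
  { eapply Rle_trans; [eassumption|]. rewrite Rmult_comm. apply Rmult_le_compat_r; [apply pow2_ge_0|lra]. }
  assert (H7 : Rabs ((exp a - 1) * b) <= exp r * r ^ 2).
  { rewrite Rabs_mult. apply Rle_trans with (Rabs a * exp (Rabs a) * Rabs b).
    - apply Rmult_le_compat_r; [apply Rabs_pos|lra].
    - rewrite (Rmult_comm (Rabs a)), Rmult_assoc.
      pose proof (Rabs_pos a). pose proof (Rabs_pos b).
      rewrite <- (pow2_abs a), <- (pow2_abs b) in Hr.
      apply Rmult_le_compat; try lra. nra. nra. }
  pose proof (Rabs_triang (exp a * (cos b - 1)) (exp a - 1 - a)).
  pose proof (Rabs_triang (exp a * (sin b - b)) ((exp a - 1) * b)).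
  assert (exp r * r ^ 2 = exp r * a ^ 2 + exp r * b ^ 2) by (rewrite Hr; ring).
  pose proof (pow2_ge_0 a). pose proof (pow2_ge_0 b). nra.
Qed.

(** Componentwise, so that real limit rules apply directly. [filterlim_Clim] identifies it with the
    filter limit, the balls of [C_UniformSpace] being products of intervals. *)
Definition is_Clim_seq (s : nat -> C) (l : C) : Prop :=
  is_lim_seq (fun n => fst (s n)) (fst l) /\ is_lim_seq (fun n => snd (s n)) (snd l).

Lemma is_Clim_seq_ext s t l : (forall n, s n = t n) -> is_Clim_seq s l -> is_Clim_seq t l.
Proof.
  intros H [H1 H2]. split; [apply (is_lim_seq_ext _ _ _ (fun n => f_equal fst (H n)) H1)|
    apply (is_lim_seq_ext _ _ _ (fun n => f_equal snd (H n)) H2)].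
Qed.

Lemma is_Clim_seq_const c : is_Clim_seq (fun _ => c) c.
Proof. split; apply is_lim_seq_const. Qed.

Lemma is_Clim_seq_plus s t l m :
  is_Clim_seq s l -> is_Clim_seq t m -> is_Clim_seq (fun n => (s n + t n)%C) (l + m).
Proof. intros [H1 H2] [H3 H4]. split; simpl; now apply is_lim_seq_plus'. Qed.

Lemma is_Clim_seq_mult s t l m :
  is_Clim_seq s l -> is_Clim_seq t m -> is_Clim_seq (fun n => (s n * t n)%C) (l * m).
Proof.
  intros [H1 H2] [H3 H4]. split; simpl.
  - apply is_lim_seq_minus'; now apply is_lim_seq_mult'.
  - apply is_lim_seq_plus'; now apply is_lim_seq_mult'.
Qed.

Lemma is_Clim_seq_Cexp s l : is_Clim_seq s l -> is_Clim_seq (fun n => Cexp (s n)) (Cexp l).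
Proof.
  intros [H1 H2].
  assert (He := is_lim_seq_continuous exp _ _ (derivable_continuous_pt _ _ (derivable_pt_exp (fst l))) H1).
  split; simpl; apply is_lim_seq_mult'; try exact He.
  - apply (is_lim_seq_continuous cos _ _ (continuity_cos (snd l)) H2).
  - apply (is_lim_seq_continuous sin _ _ (continuity_sin (snd l)) H2).
Qed.

Lemma is_Clim_seq_Cmod s l : is_Clim_seq s l -> is_lim_seq (fun n => Cmod (s n)) (Cmod l).
Proof.
  intros [H1 H2]. unfold Cmod. apply is_lim_seq_continuous.
  - apply continuity_pt_sqrt. nra.
  - simpl. apply is_lim_seq_plus';
      (apply is_lim_seq_mult'; [|apply is_lim_seq_mult'; [|apply is_lim_seq_const]]); assumption.
Qed.

Lemma is_Clim_seq_unique s l m : is_Clim_seq s l -> is_Clim_seq s m -> l = m.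
Proof.
  intros [H1 H2] [H3 H4]. apply injective_projections.
  - apply is_lim_seq_unique in H1. apply is_lim_seq_unique in H3. congruence.
  - apply is_lim_seq_unique in H2. apply is_lim_seq_unique in H4. congruence.
Qed.

Lemma is_Clim_seq_incr_1 s l : is_Clim_seq (fun n => s (S n)) l <-> is_Clim_seq s l.
Proof.
  unfold is_Clim_seq. rewrite <- !(is_lim_seq_incr_1 (fun n => fst (s n))).
  now rewrite <- !(is_lim_seq_incr_1 (fun n => snd (s n))).
Qed.

Lemma filterlim_Clim (s : nat -> C) (l : C) :
  is_Clim_seq s l <-> filterlim s eventually (@locally C_UniformSpace l).
Proof.
  split.
  - intros [H1 H2]. apply (filterlim_locally (U := C_UniformSpace) s l). intros eps.
    apply (filter_and (F := eventually)
      (fun n => ball (fst l) eps (fst (s n))) (fun n => ball (snd l) eps (snd (s n)))).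
    + exact (proj1 (filterlim_locally (fun n => fst (s n)) (fst l)) H1 eps).
    + exact (proj1 (filterlim_locally (fun n => snd (s n)) (snd l)) H2 eps).
  - intros H. pose proof (proj1 (filterlim_locally (U := C_UniformSpace) s l) H) as H'.
    split.
    + apply (filterlim_locally (fun n => fst (s n)) (fst l)). intros eps.
      generalize (H' eps). apply filter_imp. now intros n [? ?].
    + apply (filterlim_locally (fun n => snd (s n)) (snd l)). intros eps.
      generalize (H' eps). apply filter_imp. now intros n [? ?].
Qed.

(** The majorant is of order [1 / n^2] and telescopes, which gives the Cauchy estimate [M / (n + 1)]
    at once. *)
Lemma Cseq_cvg (s : nat -> C) (M : R) :
  (forall n, Cmod (s (S n) - s n) <= M * (/ INR (S n) - / INR (S (S n)))) ->
  exists l, is_Clim_seq s l.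
Proof.
  intros H.
  assert (Hpos : forall n, 0 < / INR (S n)) by (intros; apply Rinv_0_lt_compat, lt_0_INR; lia).
  assert (Hd : forall n p, Cmod (s (n + p)%nat - s n) <= M * (/ INR (S n) - / INR (S (n + p)))).
  { intros n p. induction p as [|p IH].
    - rewrite Nat.add_0_r. replace (s n - s n)%C with (RtoC 0) by ring. rewrite Cmod_0. right; ring.
    - rewrite Nat.add_succ_r.
      replace (s (S (n + p)) - s n)%C with ((s (S (n + p)) - s (n + p)%nat) + (s (n + p)%nat - s n))%C by ring.
      eapply Rle_trans; [apply Cmod_triangle|]. specialize (H (n + p)%nat). lra. }
  assert (HM : 0 <= M).
  { specialize (H O). pose proof (Cmod_ge_0 (s 1%nat - s 0%nat)). simpl INR in H.
    rewrite Rinv_1 in H. lra. }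
  assert (Hd' : forall n p, (n <= p)%nat -> Cmod (s p - s n) <= M * / INR (S n)).
  { intros n p Hnp. replace p with (n + (p - n))%nat by lia.
    eapply Rle_trans; [apply Hd|]. apply Rmult_le_compat_l; [lra|].
    specialize (Hpos (n + (p - n))%nat). lra. }
  assert (Hc : forall g : C -> R, (forall c d, Rabs (g c - g d) <= Cmod (c - d)) ->
     ex_finite_lim_seq (fun n => g (s n))).
  { intros g Hg. apply ex_lim_seq_cauchy_corr. intros eps. pose proof (cond_pos eps).
    destruct (INR_unbounded (2 * M / eps)) as [N HN].
    assert (HN2 : M * / INR (S N) < eps / 2).
    { apply (Rmult_lt_reg_r (INR (S N) * 2)); [rewrite S_INR; pose proof (pos_INR N); lra|].
      replace (M * / INR (S N) * (INR (S N) * 2)) with (2 * M)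
        by (field; apply not_0_INR; lia).
      replace (2 * M) with (2 * M / eps * eps) by (field; lra).
      rewrite S_INR. nra. }
    exists N. intros n p Hn Hp.
    pose proof (Hd' N n Hn). pose proof (Hd' N p Hp).
    pose proof (Hg (s n) (s N)) as Ha. pose proof (Hg (s p) (s N)) as Hb.
    apply Rabs_le_between in Ha. apply Rabs_le_between in Hb. apply Rabs_def1; lra. }
  destruct (Hc fst) as [l1 H1].
  { intros c d. apply (re_le_Cmod (c - d)). }
  destruct (Hc snd) as [l2 H2].
  { intros c d. eapply Rle_trans; [apply Rmax_r|apply (Rmax_Cmod (c - d)%C)]. }
  exists (l1, l2). split; assumption.
Qed.

Fixpoint Cprod (a : nat -> C) (n : nat) : C :=
  match n with O => a O | S k => (Cprod a k * a (S k))%C end.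

(** [2 - 1 / (n + 1)] majorises the sum of [1 / k^2] for [1 <= k <= n + 1]; it passes the induction
    because [1 / (n + 2)^2 <= 1 / (n + 1) - 1 / (n + 2)]. The rest is [1 + t <= exp t]. *)
Lemma Cprod_near_1 (a : nat -> C) (d : R) (n : nat) :
  (forall k, Cmod (a k - 1) <= d / INR (S k) ^ 2) ->
  Cmod (Cprod a n - 1) <= exp (d * (2 - / INR (S n))) - 1.
Proof.
  intros H.
  pose proof exp_ineq1_le as He.
  induction n as [|n IH].
  - simpl Cprod. eapply Rle_trans; [apply H|]. simpl INR.
    replace (d * (2 - / 1)) with d by field. specialize (He d). simpl. lra.
  - change (Cprod a (S n)) with (Cprod a n * a (S n))%C. set (P := Cprod a n) in *.
    specialize (H (S n)). set (t := d / INR (S (S n)) ^ 2) in *.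
    replace (P * a (S n) - 1)%C with ((P - 1) * (a (S n) - 1) + (P - 1) + (a (S n) - 1))%C by ring.
    pose proof (Cmod_triangle ((P - 1) * (a (S n) - 1) + (P - 1)) (a (S n) - 1)).
    pose proof (Cmod_triangle ((P - 1) * (a (S n) - 1)) (P - 1)) as H1.
    rewrite Cmod_mult in H1.
    pose proof (Cmod_ge_0 (P - 1)). pose proof (Cmod_ge_0 (a (S n) - 1)).
    set (e := exp (d * (2 - / INR (S n)))) in *.
    apply Rle_trans with (e * (1 + t) - 1); [nra|].
    assert (Hd : 0 <= d).
    { unfold t in H. assert (0 < INR (S (S n)) ^ 2) by (apply pow_lt, lt_0_INR; lia).
      apply (Rmult_le_reg_r (/ INR (S (S n)) ^ 2)); [now apply Rinv_0_lt_compat|].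
      unfold Rdiv in H. lra. }
    assert (Ht : d * (2 - / INR (S n)) + t <= d * (2 - / INR (S (S n)))).
    { unfold t. rewrite !S_INR. pose proof (pos_INR n) as Hn. set (x := INR n) in *.
      assert (Hx : / (x + 1 + 1) ^ 2 <= / (x + 1) - / (x + 1 + 1)).
      { replace (/ (x + 1) - / (x + 1 + 1)) with (/ ((x + 1) * (x + 1 + 1))) by (field; lra).
        apply Rinv_le_contravar; nra. }
      unfold Rdiv. nra. }
    apply exp_le in Ht. rewrite exp_plus in Ht. fold e in Ht.
    assert (e * (1 + t) <= e * exp t) by (apply Rmult_le_compat_l; [apply Rlt_le, exp_pos|apply He]).
    lra.
Qed.

Lemma Cprod_bound (a : nat -> C) (d : R) (n : nat) :
  0 <= d -> (forall k, Cmod (a k - 1) <= d / INR (S k) ^ 2) ->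
  Cmod (Cprod a n - 1) <= 2 * d * exp (2 * d).
Proof.
  intros Hd H. eapply Rle_trans; [apply (Cprod_near_1 a d n H)|].
  apply Rle_trans with (exp (2 * d) - 1).
  - apply Rplus_le_compat_r, exp_le.
    assert (0 < / INR (S n)) by (apply Rinv_0_lt_compat, lt_0_INR; lia). nra.
  - pose proof (abs_exp_sub_1_le (2 * d)) as H1. apply Rabs_le_between in H1.
    rewrite (Rabs_pos_eq (2 * d)) in H1 by lra. lra.
Qed.

(** The factor [d] in the bound matters: with [d] proportional to [|h|^2] it becomes the quadratic
    remainder from which the derivative of Gamma is read off. *)
Lemma Cprod_cvg (a : nat -> C) (d : R) :
  0 <= d -> (forall k, Cmod (a k - 1) <= d / INR (S k) ^ 2) ->
  exists P, is_Clim_seq (Cprod a) P /\ Cmod (P - 1) <= 2 * d * exp (2 * d).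
Proof.
  intros Hd H. set (B := 2 * d * exp (2 * d)).
  destruct (Cseq_cvg (Cprod a) ((1 + B) * d)) as [P HP].
  - intros n. change (Cprod a (S n)) with (Cprod a n * a (S n))%C.
    replace (Cprod a n * a (S n) - Cprod a n)%C with (Cprod a n * (a (S n) - 1))%C by ring.
    rewrite Cmod_mult, Rmult_assoc.
    apply Rmult_le_compat; try apply Cmod_ge_0.
    + replace (Cprod a n) with (1 + (Cprod a n - 1))%C by ring.
      eapply Rle_trans; [apply Cmod_triangle|]. rewrite Cmod_1.
      apply Rplus_le_compat_l. now apply Cprod_bound.
    + eapply Rle_trans; [apply H|]. unfold Rdiv. apply Rmult_le_compat_l; [lra|].
      rewrite !S_INR. pose proof (pos_INR n) as Hn. set (x := INR n) in *.
      replace (/ (x + 1) - / (x + 1 + 1)) with (/ ((x + 1) * (x + 1 + 1))) by (field; lra).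
      apply Rinv_le_contravar; nra.
  - exists P. split; [exact HP|].
    apply (is_lim_seq_le (fun n => Cmod (Cprod a n - 1)) (fun _ => B) (Cmod (P - 1)) B).
    + intros n. now apply Cprod_bound.
    + apply (is_Clim_seq_Cmod (fun n => (Cprod a n - 1)%C) (P - 1)).
      apply is_Clim_seq_plus; [exact HP|apply is_Clim_seq_const].
    + apply is_lim_seq_const.
Qed.

(** * The digamma function as a limit *)

Fixpoint Charmonic (z : C) (n : nat) : C :=
  match n with
  | O => (/ z)%C
  | S k => (Charmonic z k + / (z + RtoC (INR (S k))))%C
  end.

(** The logarithmic derivative in [z] of [gauss_seq z n], just as [Charmonic z n] is that of
    [Cpoch z n]. *)
Definition digamma_seq (z : C) (n : nat) : C := (RtoC (ln (INR n)) - Charmonic z n)%C.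

(** A quantitative distance to the poles [- k], linear in [k], so that [h / (z + k)] is
    [O(|h| / (k + 1))] with one constant that can be shared by all nearby points. *)
Definition away_from_poles (c : R) (z : C) : Prop :=
  0 < c /\ forall k, c * INR (S k) <= Cmod (z + RtoC (INR k)).

Lemma away_neq_0 c z k : away_from_poles c z -> (z + RtoC (INR k))%C <> 0.
Proof.
  intros [Hc H]. apply Cmod_gt_0. eapply Rlt_le_trans; [|apply H].
  apply Rmult_lt_0_compat; [exact Hc|apply lt_0_INR; lia].
Qed.

Lemma away_neq_0_base c z : away_from_poles c z -> z <> 0.
Proof.
  intros H. pose proof (away_neq_0 c z 0 H) as H0. simpl in H0.
  now replace (z + 0)%C with z in H0 by ring.
Qed.

Lemma Cpoch_neq_0 c z n : away_from_poles c z -> Cpoch z n <> 0.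
Proof.
  intros H. induction n as [|n IH]; cbn [Cpoch].
  - now apply (away_neq_0_base c).
  - apply Cmult_neq_0; [exact IH|now apply (away_neq_0 c)].
Qed.

(* Weierstrass-type factor: with [w = h / (z + k)] it is [exp w / (1 + w) = 1 + O(w ^ 2)]. *)
Definition shift_factor (z h : C) (k : nat) : C :=
  (Cexp (h / (z + RtoC (INR k))) * ((z + RtoC (INR k)) / (z + h + RtoC (INR k))))%C.

Lemma Cprod_shift_factor c c' z h n :
  away_from_poles c z -> away_from_poles c' (z + h) ->
  Cprod (shift_factor z h) n = (Cexp (h * Charmonic z n) * (Cpoch z n / Cpoch (z + h) n))%C.
Proof.
  intros H H'. induction n as [|n IH].
  - cbn [Cprod Charmonic Cpoch]. unfold shift_factor. simpl INR.
    replace (z + 0)%C with z by ring. replace (z + h + 0)%C with (z + h)%C by ring. reflexivity.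
  - cbn [Cprod Charmonic Cpoch]. rewrite IH. unfold shift_factor.
    set (w := RtoC (INR (S n))).
    rewrite Cmult_plus_distr_l, Cexp_plus.
    pose proof (Cpoch_neq_0 c' _ n H'). pose proof (away_neq_0 c' _ (S n) H'). fold w in H1.
    change (h * / (z + w))%C with (h / (z + w))%C. set (e := Cexp (h / (z + w))).
    field. now split.
Qed.

(** In the extra factor [n^h], write [ln n] as [digamma_seq z n + Charmonic z n]; the harmonic part
    is distributed over the factors [(z + k) / (z + h + k)] and makes their product converge. *)
Lemma gauss_seq_shift c c' z h n :
  away_from_poles c z -> away_from_poles c' (z + h) ->
  gauss_seq (z + h) n
  = (gauss_seq z n * (Cexp (h * digamma_seq z n) * Cprod (shift_factor z h) n))%C.
Proof.
  intros H H'. rewrite (Cprod_shift_factor c c') by assumption.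
  unfold gauss_seq, digamma_seq. set (L := RtoC (ln (INR n))).
  replace (Cexp ((z + h) * L)) with (Cexp (z * L) * (Cexp (h * (L - Charmonic z n)) * Cexp (h * Charmonic z n)))%C.
  - pose proof (Cpoch_neq_0 c' _ n H'). pose proof (Cpoch_neq_0 c _ n H). field. now split.
  - rewrite <- !Cexp_plus. f_equal. ring.
Qed.

(** With [x = z + k], the difference is [x / (x + h)] times the second-order remainder of [exp] at
    [h / x]. The quotient is bounded since numerator and denominator both grow linearly in [k]; [B]
    only serves to bound the exponential in that remainder. *)
Lemma shift_factor_near_1 c z h B k :
  away_from_poles c z -> away_from_poles c (z + h) -> Cmod h <= B ->
  Cmod (shift_factor z h k - 1)
  <= (Cmod z + 1) / c * (4 * exp (B / c)) / c ^ 2 * Cmod h ^ 2 / INR (S k) ^ 2.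
Proof.
  intros H H' HB. pose proof (away_neq_0 c z k H) as Hn. pose proof (away_neq_0 c _ k H') as Hn'.
  destruct H as [Hc Hk]. destruct H' as [_ Hk']. specialize (Hk k). specialize (Hk' k).
  unfold shift_factor. set (x := (z + RtoC (INR k))%C) in *.
  replace (z + h + RtoC (INR k))%C with (x + h)%C in * by (unfold x; ring).
  replace (Cexp (h / x) * (x / (x + h)) - 1)%C
    with (x / (x + h) * (Cexp (h / x) - 1 - h / x))%C by (field; now split).
  rewrite Cmod_mult, Cmod_div by assumption.
  assert (HS : 0 < INR (S k)) by (apply lt_0_INR; lia).
  assert (HS1 : 1 <= INR (S k)) by (rewrite S_INR; pose proof (pos_INR k); lra).
  set (N := INR (S k)) in *.
  assert (Hx : Cmod x <= (Cmod z + 1) * N).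
  { unfold x. eapply Rle_trans; [apply Cmod_triangle|]. rewrite Cmod_R.
    rewrite Rabs_pos_eq by apply pos_INR. unfold N. rewrite S_INR in *.
    pose proof (Cmod_ge_0 z). pose proof (pos_INR k). nra. }
  assert (Hcn : 0 < c * N) by (apply Rmult_lt_0_compat; lra).
  assert (H1 : Cmod x / Cmod (x + h) <= (Cmod z + 1) / c).
  { replace ((Cmod z + 1) / c) with ((Cmod z + 1) * N * / (c * N)) by (field; lra).
    apply Rmult_le_compat; [apply Cmod_ge_0| |exact Hx|apply Rinv_le_contravar; lra].
    apply Rlt_le, Rinv_0_lt_compat. lra. }
  assert (H2 : Cmod (h / x) <= Cmod h * / (c * N)).
  { rewrite Cmod_div by assumption. apply Rmult_le_compat_l; [apply Cmod_ge_0|].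
    apply Rinv_le_contravar; lra. }
  assert (H3 : Cmod h * / (c * N) <= B / c).
  { apply Rmult_le_compat; [apply Cmod_ge_0| |exact HB|].
    - apply Rlt_le, Rinv_0_lt_compat. lra.
    - apply Rinv_le_contravar; nra. }
  assert (H4 : Cmod (Cexp (h / x) - 1 - h / x) <= 4 * exp (B / c) * (Cmod h * / (c * N)) ^ 2).
  { eapply Rle_trans; [apply Cexp_remainder|].
    pose proof (exp_pos (Cmod (h / x))).
    apply Rmult_le_compat; [lra|apply pow2_ge_0| |apply pow_incr; split; [apply Cmod_ge_0|lra]].
    apply Rmult_le_compat_l; [lra|]. apply exp_le. lra. }
  eapply Rle_trans; [apply Rmult_le_compat|]; [|apply Cmod_ge_0|exact H1|exact H4|right; field; lra].
  apply Rmult_le_pos; [apply Cmod_ge_0|]. apply Rlt_le, Rinv_0_lt_compat. lra.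
Qed.

(** [M] is fixed before [h], as differentiation requires. The radius [B] is arbitrary because the
    long shifts between 1 and [z] go through the same estimate. *)
Lemma gauss_shift_cvg c z B :
  away_from_poles c z ->
  exists M, forall h, away_from_poles c (z + h) -> Cmod h <= B ->
  exists P, is_Clim_seq (Cprod (shift_factor z h)) P /\ Cmod (P - 1) <= M * Cmod h ^ 2.
Proof.
  intros H. assert (Hc := proj1 H).
  set (A := (Cmod z + 1) / c * (4 * exp (B / c)) / c ^ 2).
  assert (HA : 0 <= A).
  { pose proof (Cmod_ge_0 z). pose proof (exp_pos (B / c)).
    assert (0 < / c) by now apply Rinv_0_lt_compat.
    unfold A, Rdiv. repeat apply Rmult_le_pos; try lra.
    apply Rlt_le, Rinv_0_lt_compat, pow_lt, Hc. }
  exists (2 * A * exp (2 * (A * B ^ 2))). intros h H' HB.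
  pose proof (Cmod_ge_0 h) as Hh.
  assert (Hd : 0 <= A * Cmod h ^ 2) by (apply Rmult_le_pos; [exact HA|apply pow2_ge_0]).
  destruct (Cprod_cvg (shift_factor z h) (A * Cmod h ^ 2) Hd) as [P [HP HP1]].
  - intros k. apply shift_factor_near_1; assumption.
  - exists P. split; [exact HP|]. eapply Rle_trans; [exact HP1|].
    replace (2 * A * exp (2 * (A * B ^ 2)) * Cmod h ^ 2)
      with (2 * (A * Cmod h ^ 2) * exp (2 * (A * B ^ 2))) by ring.
    apply Rmult_le_compat_l; [lra|]. apply exp_le.
    apply Rmult_le_compat_l; [lra|]. apply Rmult_le_compat_l; [lra|].
    apply pow_incr. lra.
Qed.

Lemma digamma_seq_cvg c z :
  away_from_poles c z -> exists l, is_Clim_seq (digamma_seq z) l.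
Proof.
  intros H. assert (Hc := proj1 H).
  (* The index starts at 1, since the term at 0 contains the default value of [ln 0]. *)
  destruct (Cseq_cvg (fun n => digamma_seq z (S n)) (1 + Cmod z / c)) as [l Hl].
  - intros n. unfold digamma_seq.
    change (Charmonic z (S (S n))) with (Charmonic z (S n) + / (z + RtoC (INR (S (S n)))))%C.
    generalize (Charmonic z (S n)). intros S0.
    pose proof (away_neq_0 c z (S (S n)) H) as Hn.
    destruct H as [_ Hk]. specialize (Hk (S (S n))).
    rewrite !S_INR in *. pose proof (pos_INR n). set (N := INR n + 1) in *.
    assert (HN : 1 <= N) by (unfold N; lra).
    set (x := (z + RtoC (N + 1))%C) in *.
    (* [1 / x] is compared with [1 / (N + 1)]: the logarithmic part lies between 0 and
       [1 / N - 1 / (N + 1)], and the correction has the order of [z / N^2]. *)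
    replace (_ - _)%C with (RtoC (ln (N + 1) - ln N - / (N + 1)) + z / (x * RtoC (N + 1)))%C.
    2:{ rewrite !RtoC_minus, RtoC_inv by lra.
        assert (HN' : RtoC (N + 1) <> 0) by (intros E; apply RtoC_inj in E; lra).
        replace z with (x - RtoC (N + 1))%C at 1 by (unfold x; ring).
        field. now split. }
    eapply Rle_trans; [apply Cmod_triangle|].
    rewrite Rmult_plus_distr_r, Rmult_1_l. apply Rplus_le_compat.
    + rewrite Cmod_R.
      assert (Hln1 : ln (N + 1) - ln N <= / N).
      { rewrite <- ln_div by lra. rewrite <- (ln_exp (/ N)). apply ln_le.
        - apply Rdiv_lt_0_compat; lra.
        - replace ((N + 1) / N) with (1 + / N) by (field; lra). apply exp_ineq1_le. }
      assert (Hln2 : ln N - ln (N + 1) <= - / (N + 1)).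
      { rewrite <- ln_div by lra. rewrite <- (ln_exp (- / (N + 1))). apply ln_le.
        - apply Rdiv_lt_0_compat; lra.
        - replace (N / (N + 1)) with (1 + - / (N + 1)) by (field; lra). apply exp_ineq1_le. }
      rewrite Rabs_pos_eq; lra.
    + assert (HN' : RtoC (N + 1) <> 0) by (intros E; apply RtoC_inj in E; lra).
      rewrite Cmod_div by now apply Cmult_neq_0.
      rewrite Cmod_mult, Cmod_R, Rabs_pos_eq by lra.
      replace (Cmod z / c * (/ N - / (N + 1))) with (Cmod z * / (c * (N * (N + 1)))) by (field; lra).
      apply Rmult_le_compat_l; [apply Cmod_ge_0|].
      apply Rinv_le_contravar; [repeat apply Rmult_lt_0_compat; lra|].
      rewrite <- Rmult_assoc. apply Rmult_le_compat_r; [lra|]. nra.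
  - exists l. exact (proj1 (is_Clim_seq_incr_1 (digamma_seq z) l) Hl).
Qed.

Lemma away_1 : away_from_poles 1 1.
Proof.
  split; [lra|]. intros k. rewrite <- RtoC_plus, Cmod_R, S_INR.
  rewrite Rabs_pos_eq; pose proof (pos_INR k); lra.
Qed.

Lemma away_le c c' z : away_from_poles c z -> 0 < c' <= c -> away_from_poles c' z.
Proof.
  intros [Hc H] Hc'. split; [lra|]. intros k. eapply Rle_trans; [|apply H].
  apply Rmult_le_compat_r; [apply pos_INR|lra].
Qed.

Lemma gauss_seq_1 : is_Clim_seq (gauss_seq 1) 1.
Proof.
  assert (Hp : forall n, Cpoch 1 n = RtoC (INR (fact (S n)))).
  { induction n as [|n IH]; cbn [Cpoch]; [now simpl|].
    rewrite IH, <- RtoC_plus, <- RtoC_mult. f_equal.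
    change (fact (S (S n))) with ((S (S n)) * fact (S n))%nat.
    rewrite mult_INR, (S_INR (S n)). ring. }
  apply is_Clim_seq_incr_1.
  apply is_Clim_seq_ext with (fun n => RtoC (1 - / (INR n + 2))).
  { intros n. unfold gauss_seq. rewrite Hp, Cmult_1_l, Cexp_RtoC, exp_ln by (apply lt_0_INR; lia).
    rewrite <- RtoC_mult, <- RtoC_div by apply INR_fact_neq_0. f_equal.
    change (fact (S (S n))) with ((S (S n)) * fact (S n))%nat.
    rewrite mult_INR, !S_INR. pose proof (INR_fact_neq_0 (S n)). pose proof (pos_INR n).
    field. split; [assumption|lra]. }
  split; simpl; [|apply is_lim_seq_const].
  replace (Finite 1) with (Finite (1 - 0)) by (f_equal; ring).
  apply is_lim_seq_minus'; [apply is_lim_seq_const|].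
  apply (is_lim_seq_inv (fun n => INR n + 2) p_infty); [|discriminate].
  apply (is_lim_seq_plus _ _ p_infty 2); [apply is_lim_seq_INR|apply is_lim_seq_const|reflexivity].
Qed.

(* [gauss_seq 1 n = n / (n + 1)]; shifting from [1] to [z] gives convergence, and shifting back
   from [z] to [1] shows that the limit cannot vanish. *)
Lemma gauss_seq_cvg c z :
  away_from_poles c z -> exists G, is_Clim_seq (gauss_seq z) G /\ G <> 0.
Proof.
  intros H0. assert (Hc0 := proj1 H0).
  pose (c' := Rmin c 1).
  assert (Hc' : 0 < c' <= c /\ c' <= 1).
  { unfold c'. pose proof (Rmin_l c 1). pose proof (Rmin_r c 1). repeat split; try lra.
    apply Rmin_glb_lt; lra. }
  assert (H : away_from_poles c' z) by (apply (away_le c); [assumption|lra]).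
  assert (H1 : away_from_poles c' 1) by (apply (away_le 1); [apply away_1|lra]).
  assert (Ez : (1 + (z - 1))%C = z) by ring.
  assert (E1 : (z + (1 - z))%C = 1) by ring.
  destruct (digamma_seq_cvg _ _ H1) as [g1 Hg1].
  destruct (digamma_seq_cvg _ _ H) as [gz Hgz].
  destruct (gauss_shift_cvg c' 1 (Cmod (z - 1)) H1) as [M1 HM1].
  destruct (HM1 (z - 1)%C) as [P1 [HP1 _]]; [now rewrite Ez|lra|].
  destruct (gauss_shift_cvg c' z (Cmod (1 - z)) H) as [M2 HM2].
  destruct (HM2 (1 - z)%C) as [P2 [HP2 _]]; [now rewrite E1|lra|].
  assert (HG : is_Clim_seq (gauss_seq z) (1 * (Cexp ((z - 1) * g1) * P1))).
  { apply is_Clim_seq_ext with (fun n =>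
      (gauss_seq 1 n * (Cexp ((z - 1) * digamma_seq 1 n) * Cprod (shift_factor 1 (z - 1)) n))%C).
    - intros n. rewrite <- (gauss_seq_shift c' c'); rewrite ?Ez; auto.
    - apply is_Clim_seq_mult; [apply gauss_seq_1|]. apply is_Clim_seq_mult; [|exact HP1].
      apply is_Clim_seq_Cexp, is_Clim_seq_mult; [apply is_Clim_seq_const|exact Hg1]. }
  eexists. split; [exact HG|]. intros E. rewrite E in HG.
  assert (HG1 : is_Clim_seq (gauss_seq 1) (0 * (Cexp ((1 - z) * gz) * P2))).
  { apply is_Clim_seq_ext with (fun n =>
      (gauss_seq z n * (Cexp ((1 - z) * digamma_seq z n) * Cprod (shift_factor z (1 - z)) n))%C).
    - intros n. rewrite <- (gauss_seq_shift c' c'); rewrite ?E1; auto.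
    - apply is_Clim_seq_mult; [exact HG|]. apply is_Clim_seq_mult; [|exact HP2].
      apply is_Clim_seq_Cexp, is_Clim_seq_mult; [apply is_Clim_seq_const|exact Hgz]. }
  pose proof (is_Clim_seq_unique _ _ _ gauss_seq_1 HG1) as E'.
  rewrite Cmult_0_l in E'. now apply C1_nz.
Qed.

(** [lim] is a total function, specified on proper Cauchy filters only. Convergence to [l] supplies
    the Cauchy property, and uniqueness of limits then identifies the value. *)
Lemma lim_C_unique (F : (C -> Prop) -> Prop) (l : C) :
  ProperFilter F -> filter_le F (@locally C_UniformSpace l) ->
  @lim C_R_CompleteNormedModule F = l.
Proof.
  intros HF Hl.
  apply (is_filter_lim_unique (K := R_AbsRing) (V := C_R_NormedModule) (F := F)); [|exact Hl].
  intros P [eps HP].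
  assert (Hc : cauchy (T := C_R_CompleteNormedModule) F).
  { intros e. exists l. apply Hl. exists e. intros y Hy. exact Hy. }
  generalize (complete_cauchy (T := C_R_CompleteNormedModule) F HF Hc eps).
  apply filter_imp. intros y Hy. apply HP, Hy.
Qed.

Lemma CGamma_eq z G : is_Clim_seq (gauss_seq z) G -> CGamma z = G.
Proof.
  intros H. unfold CGamma. apply lim_C_unique.
  - apply filtermap_proper_filter, eventually_filter.
  - exact (proj1 (filterlim_Clim _ _) H).
Qed.

(** The factorisation passes to the limit as [Gamma (z + h) = Gamma z exp (h g) P] with
    [P = 1 + O(h^2)]; expanding the exponential to first order leaves a quadratic remainder. *)
Lemma CGamma_increment c z g B :
  away_from_poles c z -> is_Clim_seq (digamma_seq z) g ->
  exists M, forall h, away_from_poles c (z + h) -> Cmod h <= B ->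
    Cmod (CGamma (z + h) - CGamma z - h * (CGamma z * g)) <= M * Cmod h ^ 2.
Proof.
  intros H Hg. destruct (gauss_shift_cvg c z B H) as [M HM].
  destruct (gauss_seq_cvg c z H) as [G [HG _]]. rewrite (CGamma_eq z G HG).
  set (E := exp (Cmod g * B)).
  exists (Cmod G * (E * M + 4 * E * Cmod g ^ 2)). intros h H' HB.
  destruct (HM h H' HB) as [P [HP HP1]].
  rewrite (CGamma_eq (z + h) (G * (Cexp (h * g) * P))).
  - replace (G * (Cexp (h * g) * P) - G - h * (G * g))%C
      with (G * (Cexp (h * g) * (P - 1) + (Cexp (h * g) - 1 - h * g)))%C by ring.
    rewrite Cmod_mult, Rmult_assoc. apply Rmult_le_compat_l; [apply Cmod_ge_0|].
    eapply Rle_trans; [apply Cmod_triangle|].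
    assert (Hhg : Cmod (h * g) <= Cmod g * B).
    { rewrite Cmod_mult, Rmult_comm. apply Rmult_le_compat_l; [apply Cmod_ge_0|exact HB]. }
    assert (HE : exp (Cmod (h * g)) <= E) by (unfold E; now apply exp_le).
    rewrite Rmult_plus_distr_r. apply Rplus_le_compat.
    + rewrite Cmod_mult, Rmult_assoc. apply Rmult_le_compat; try apply Cmod_ge_0; [|exact HP1].
      eapply Rle_trans; [apply Cmod_Cexp_le|exact HE].
    + eapply Rle_trans; [apply Cexp_remainder|].
      rewrite Cmod_mult, Rpow_mult_distr in *.
      replace (4 * E * Cmod g ^ 2 * Cmod h ^ 2) with (4 * E * (Cmod h ^ 2 * Cmod g ^ 2)) by ring.
      apply Rmult_le_compat_r; [|lra].
      apply Rmult_le_pos; apply pow2_ge_0.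
  - apply is_Clim_seq_ext with (fun n =>
      (gauss_seq z n * (Cexp (h * digamma_seq z n) * Cprod (shift_factor z h) n))%C).
    + intros n. now rewrite <- (gauss_seq_shift c c).
    + apply is_Clim_seq_mult; [exact HG|]. apply is_Clim_seq_mult; [|exact HP].
      apply is_Clim_seq_Cexp, is_Clim_seq_mult; [apply is_Clim_seq_const|exact Hg].
Qed.

(** With [x = z + k], both [b <= |x|] and [k <= |x| + r] hold, so [k + 1 <= |x| + (r + 1) <= (1 + (r
    + 1) / b) |x|]. The constant depends on [b] and [r] alone. *)
Lemma away_from_poles_Im z b : 0 < b -> b <= Rabs (Im z) ->
  forall r, Cmod z <= r -> away_from_poles (/ (1 + (r + 1) / b)) z.
Proof.
  intros Hb Hz r Hr. pose proof (Cmod_ge_0 z).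
  assert (Hd : 0 < 1 + (r + 1) / b).
  { assert (0 < (r + 1) / b) by (apply Rdiv_lt_0_compat; lra). lra. }
  split; [now apply Rinv_0_lt_compat|]. intros k.
  apply (Rmult_le_reg_l (1 + (r + 1) / b)); [exact Hd|].
  rewrite <- Rmult_assoc, Rinv_r, Rmult_1_l by lra.
  set (x := (z + RtoC (INR k))%C).
  assert (Hx : b <= Cmod x).
  { eapply Rle_trans; [exact Hz|]. replace (Im z) with (snd x) by (unfold x; simpl; unfold Im; ring).
    eapply Rle_trans; [apply Rmax_r|apply (Rmax_Cmod x)]. }
  assert (Hk : INR k <= Cmod x + r).
  { replace (INR k) with (Cmod (x + - z)).
    - eapply Rle_trans; [apply Cmod_triangle|]. rewrite Cmod_opp. lra.
    - replace (x + - z)%C with (RtoC (INR k)) by (unfold x; ring).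
      rewrite Cmod_R. apply Rabs_pos_eq, pos_INR. }
  rewrite S_INR.
  assert (r + 1 <= (r + 1) / b * Cmod x).
  { replace (r + 1) with ((r + 1) / b * b) at 1 by (field; lra).
    apply Rmult_le_compat_l; [apply Rlt_le, Rdiv_lt_0_compat; lra|exact Hx]. }
  lra.
Qed.

Lemma locally'_C_proper (z : C) : ProperFilter (@locally' C_UniformSpace z).
Proof.
  split; [|apply locally'_filter].
  intros P [eps HP]. exists (fst z + eps / 2, snd z). pose proof (cond_pos eps).
  apply HP.
  - split; [change (Rabs (fst z + eps / 2 - fst z) < eps)|change (Rabs (snd z - snd z) < eps)].
    + rewrite Rabs_pos_eq; lra.
    + rewrite Rminus_diag, Rabs_R0; lra.
  - intros E. apply (f_equal fst) in E. simpl in E. lra.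
Qed.

Lemma CDerive_eq (f : C -> C) (z d : C) (M : R) (r : posreal) :
  (forall h, Cmod h <= r -> Cmod (f (z + h)%C - f z - h * d) <= M * Cmod h ^ 2) ->
  CDerive f z = d.
Proof.
  intros H. unfold CDerive. apply lim_C_unique.
  { apply filtermap_proper_filter, locally'_C_proper. }
  intros P [eps HP]. unfold filtermap.
  pose proof (cond_pos r). pose proof (cond_pos eps).
  set (M' := Rabs M + 1). assert (HM' : 0 < M' /\ M < M').
  { unfold M'. pose proof (Rabs_pos M). pose proof (Rle_abs M). lra. }
  set (e := Rmin r (eps / (2 * M'))).
  assert (He : 0 < e) by (apply Rmin_glb_lt; [lra|apply Rdiv_lt_0_compat; lra]).
  assert (He2 : 0 < e / 2) by lra.
  (* Balls are squares here: a bound [e / 2] on each coordinate gives [Cmod h <= e]. *)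
  exists (mkposreal _ He2). intros h Hh Hh0. apply HP.
  assert (Hh1 : Cmod h <= e).
  { destruct Hh as [Ha Hb]. destruct h as [h1 h2].
    change (Rabs (h1 - 0) < e / 2) in Ha. change (Rabs (h2 - 0) < e / 2) in Hb.
    rewrite Rminus_0_r in *. pose proof (Cmod_le_abs h1 h2). lra. }
  assert (Hh2 : 0 < Cmod h) by (apply Cmod_gt_0; exact Hh0).
  pose proof (Rmin_l r (eps / (2 * M'))) as Hl. pose proof (Rmin_r r (eps / (2 * M'))) as Hr. fold e in Hl, Hr.
  specialize (H h ltac:(lra)).
  assert (HD : Cmod ((f (z + h)%C - f z) / h - d) < eps).
  { replace ((f (z + h)%C - f z) / h - d)%C with ((f (z + h)%C - f z - h * d) / h)%C by (field; exact Hh0).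
    rewrite Cmod_div by exact Hh0.
    apply (Rmult_lt_reg_r (Cmod h)); [exact Hh2|].
    unfold Rdiv. rewrite Rmult_assoc, Rinv_l, Rmult_1_r by lra.
    eapply Rle_lt_trans; [exact H|].
    replace (M * Cmod h ^ 2) with (M * Cmod h * Cmod h) by ring.
    apply Rmult_lt_compat_r; [exact Hh2|].
    apply Rle_lt_trans with (M' * e); [nra|].
    apply Rle_lt_trans with (M' * (eps / (2 * M'))); [apply Rmult_le_compat_l; lra|].
    replace (M' * (eps / (2 * M'))) with (eps / 2) by (field; lra). lra. }
  pose proof (Rmax_Cmod ((f (z + h)%C - f z) / h - d)%C) as Hm.
  split.
  - change (Rabs (fst ((f (z + h)%C - f z) / h - d)%C) < eps).
    eapply Rle_lt_trans; [apply Rmax_l|]. eapply Rle_lt_trans; [exact Hm|exact HD].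
  - change (Rabs (snd ((f (z + h)%C - f z) / h - d)%C) < eps).
    eapply Rle_lt_trans; [apply Rmax_r|]. eapply Rle_lt_trans; [exact Hm|exact HD].
Qed.

Lemma digamma_lim (z : C) : Im z <> 0 -> is_Clim_seq (digamma_seq z) (digamma z).
Proof.
  (* With half of [|Im z|] as radius, every [z + h] in the disc keeps [b <= |Im (z + h)|], so one
     constant [c] covers the disc. *)
  intros Hz. set (b := Rabs (Im z) / 2).
  assert (Hb : 0 < b) by (unfold b; apply Rabs_pos_lt in Hz; lra).
  pose (c := / (1 + (Cmod z + b + 1) / b)).
  assert (H : away_from_poles c z) by (apply away_from_poles_Im; unfold b in *; lra).
  destruct (digamma_seq_cvg c z H) as [g Hg].
  destruct (CGamma_increment c z g b H Hg) as [M HM].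
  destruct (gauss_seq_cvg c z H) as [G [HG HG0]]. apply CGamma_eq in HG.
  assert (HD : CDerive CGamma z = (CGamma z * g)%C).
  { apply (CDerive_eq _ _ _ M (mkposreal b Hb)). intros h Hh. simpl in Hh. apply HM; [|exact Hh].
    apply away_from_poles_Im; [exact Hb| |eapply Rle_trans; [apply Cmod_triangle|lra]].
    assert (Hi : Rabs (snd h) <= b).
    { eapply Rle_trans; [apply Rmax_r|]. eapply Rle_trans; [apply (Rmax_Cmod h)|exact Hh]. }
    replace (Im (z + h)) with (Im z - - snd h) by (simpl; unfold Im; ring).
    eapply Rle_trans; [|apply Rabs_triang_inv]. rewrite Rabs_Ropp.
    replace (Rabs (Im z)) with (2 * b) by (unfold b; field). lra. }
  unfold digamma. rewrite HD, HG. replace (G * g / G)%C with g by (field; exact HG0). exact Hg.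
Qed.

(** * Poisson summation for [1 / (x + z)] *)

Lemma atan_lim : is_lim atan p_infty (PI / 2).
Proof.
  apply is_lim_spec. intros eps. pose proof (cond_pos eps). pose proof PI_RGT_0.
  set (e := Rmin eps (PI / 2)).
  assert (He : 0 < e <= PI / 2 /\ e <= eps).
  { unfold e. pose proof (Rmin_l eps (PI / 2)). pose proof (Rmin_r eps (PI / 2)).
    repeat split; try lra. apply Rmin_glb_lt; lra. }
  exists (tan (PI / 2 - e)). intros x Hx.
  apply atan_increasing in Hx. rewrite atan_tan in Hx by lra.
  pose proof (atan_bound x). apply Rabs_def1; lra.
Qed.

Lemma is_lim_lin (a k : R) : 0 < k -> is_lim (fun x => (x + a) / k) p_infty p_infty.
Proof.
  intros Hk. apply is_lim_spec. intros M. exists (M * k - a). intros x Hx.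
  apply Rlt_div_r; lra.
Qed.

Lemma atan_lin_lim (a k : R) : 0 < k -> is_lim (fun x => atan ((x + a) / k)) p_infty (PI / 2).
Proof.
  intros Hk. apply (is_lim_comp atan (fun x => (x + a) / k) p_infty (PI / 2) p_infty).
  - apply atan_lim.
  - now apply is_lim_lin.
  - exists 0. intros; discriminate.
Qed.

Lemma vanish_at_infty (f : R -> R) (a K : R) :
  (forall x, 0 < x + a -> Rabs (f x) <= K / (x + a)) -> is_lim f p_infty 0.
Proof.
  intros H. apply is_lim_spec. intros eps. pose proof (cond_pos eps).
  exists (Rmax (- a) (Rabs K / eps - a)). intros x Hx.
  pose proof (Rmax_l (- a) (Rabs K / eps - a)). pose proof (Rmax_r (- a) (Rabs K / eps - a)).
  rewrite Rminus_0_r. eapply Rle_lt_trans; [apply H; lra|].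
  apply Rlt_div_l; [lra|].
  assert (H3 : Rabs K / eps < x + a) by lra. apply Rlt_div_l in H3; [|lra].
  pose proof (Rle_abs K). lra.
Qed.

Section Kernel.

Variables a b : R.
Hypothesis Hb : b <> 0.

Lemma den_pos x : 0 < (x + a) ^ 2 + b ^ 2.
Proof. pose proof (pow2_ge_0 (x + a)). assert (0 < b ^ 2) by now apply pow2_gt_0. lra. Qed.

(** The real and imaginary parts of [1 / (x + z)] for [z = (a, b)]; the primed functions are their
    derivatives. *)
Definition ker_re (x : R) : R := (x + a) / ((x + a) ^ 2 + b ^ 2).
Definition ker_im (x : R) : R := - b / ((x + a) ^ 2 + b ^ 2).
Definition ker_re' (x : R) : R := (b ^ 2 - (x + a) ^ 2) / ((x + a) ^ 2 + b ^ 2) ^ 2.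
Definition ker_im' (x : R) : R := 2 * b * (x + a) / ((x + a) ^ 2 + b ^ 2) ^ 2.

Lemma ker_re_der x : is_derive ker_re x (ker_re' x).
Proof.
  pose proof (den_pos x). unfold ker_re, ker_re'. auto_derive; [lra|]. field. lra.
Qed.

Lemma ker_im_der x : is_derive ker_im x (ker_im' x).
Proof.
  pose proof (den_pos x). unfold ker_im, ker_im'. auto_derive; [lra|]. field. lra.
Qed.

(** The second derivative [2 / (x + z)^3] of the kernel is dominated by a multiple of
    [1 / |x + z|^2], because [|x + z| >= |b|]. An arctangent is a primitive of that majorant and
    supplies the bounded weight [W]. *)
Lemma ker_weight_der K x :
  is_derive (fun t => K * atan ((t + a) / Rabs b)) x (K * Rabs b / ((x + a) ^ 2 + b ^ 2)).
Proof.
  pose proof (den_pos x). assert (Hb' : 0 < Rabs b) by now apply Rabs_pos_lt.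
  rewrite <- (pow2_abs b) in *.
  auto_derive; [lra|]. field. split; [lra|].
  replace (Rabs b * Rabs b + (x + a) * (x + a)) with ((x + a) ^ 2 + Rabs b ^ 2) by ring. lra.
Qed.

Lemma ker_weight_lim K :
  is_lim (fun t => K * atan ((t + a) / Rabs b)) p_infty (K * (PI / 2)).
Proof.
  apply (is_lim_scal_l _ K p_infty (PI / 2)), atan_lin_lim. now apply Rabs_pos_lt.
Qed.

Lemma abs_div_le (n d y : R) : 0 < y -> 0 < d -> y * Rabs n <= d -> Rabs (n / d) <= 1 / y.
Proof.
  intros Hy Hd H. unfold Rdiv. rewrite Rabs_mult, (Rabs_pos_eq (/ d)) by (apply Rlt_le, Rinv_0_lt_compat, Hd).
  apply (Rmult_le_reg_r (y * d)); [nra|].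
  replace (Rabs n * / d * (y * d)) with (y * Rabs n) by (field; lra).
  replace (1 * / y * (y * d)) with d by (field; lra). exact H.
Qed.

Lemma fourier_kernel (F f f1 f2 : R -> R) (K1 K2 K : R) :
  (forall x, is_derive F x (f x)) -> (forall x, is_derive f x (f1 x)) ->
  (forall x, is_derive f1 x (f2 x)) ->
  (forall x, 0 < x + a -> Rabs (f x) <= K1 / (x + a)) ->
  (forall x, 0 < x + a -> Rabs (f1 x) <= K2 / (x + a)) ->
  (forall x, Rabs (f2 x) <= K * Rabs b / ((x + a) ^ 2 + b ^ 2)) ->
  exists (J : nat -> R) (L : R),
    (forall m, is_lim (fun b => RInt (fun x => f x * cos (freq m * x)) 0 b) p_infty (J m)) /\
    is_lim_seq (fun n => sum_f_R0 (fun k => f (INR k)) n - (F (INR n) - F 0)) L /\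
    is_series J ((L - f 0 / 2) / 2).
Proof.
  intros HF Hf Hf1 H1 H2 H3.
  apply (fourier_summation F f f1 f2 (fun t => K * atan ((t + a) / Rabs b))
    (fun x => K * Rabs b / ((x + a) ^ 2 + b ^ 2)) (K * (PI / 2)) HF Hf Hf1).
  - intros x. apply ker_weight_der.
  - exact H3.
  - apply ker_weight_lim.
  - now apply (vanish_at_infty f a K1).
  - now apply (vanish_at_infty f1 a K2).
Qed.

Lemma fourier_ker_re :
  exists (J : nat -> R) (L : R),
    (forall m, is_lim (fun b => RInt (fun x => ker_re x * cos (freq m * x)) 0 b) p_infty (J m)) /\
    is_lim_seq (fun n => sum_f_R0 (fun k => ker_re (INR k)) n
       - (ln ((INR n + a) ^ 2 + b ^ 2) / 2 - ln ((0 + a) ^ 2 + b ^ 2) / 2)) L /\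
    is_series J ((L - ker_re 0 / 2) / 2).
Proof.
  assert (Hb' : 0 < Rabs b) by now apply Rabs_pos_lt.
  assert (Hb2 := pow2_abs b).
  apply (fourier_kernel (fun x => ln ((x + a) ^ 2 + b ^ 2) / 2) ker_re ker_re'
    (fun x => 2 * (x + a) * ((x + a) ^ 2 - 3 * b ^ 2) / ((x + a) ^ 2 + b ^ 2) ^ 3) 1 (/ Rabs b)
    (3 / b ^ 2)).
  - intros x. pose proof (den_pos x). unfold ker_re. auto_derive; [lra|]. field. lra.
  - apply ker_re_der.
  - intros x. pose proof (den_pos x). unfold ker_re'. auto_derive.
    + apply Rgt_not_eq. nra.
    + field. lra.
  - intros x Hx. apply abs_div_le; [exact Hx|apply den_pos|].
    rewrite Rabs_pos_eq by lra. pose proof (pow2_ge_0 b). simpl in *. lra.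
  - intros x Hx. pose proof (den_pos x) as Hd.
    replace (/ Rabs b / (x + a)) with (1 / (Rabs b * (x + a))) by (field; lra).
    unfold ker_re'. apply abs_div_le; [now apply Rmult_lt_0_compat|now apply pow_lt|].
    set (y := x + a) in *. rewrite <- Hb2 in *. set (c := Rabs b) in *.
    assert (Hc : Rabs (c ^ 2 - y ^ 2) <= y ^ 2 + c ^ 2) by (apply Rabs_le; nra).
    replace ((y ^ 2 + c ^ 2) ^ 2) with ((y ^ 2 + c ^ 2) * (y ^ 2 + c ^ 2)) by ring.
    apply Rmult_le_compat; [nra|apply Rabs_pos|nra|exact Hc].
  - intros x. pose proof (den_pos x) as Hd. rewrite <- Hb2 in *.
    set (y := x + a) in *. set (c := Rabs b) in *. set (D := y ^ 2 + c ^ 2) in *.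
    unfold Rdiv at 1. rewrite !Rabs_mult, (Rabs_pos_eq 2), (Rabs_pos_eq (/ D ^ 3))
      by (try lra; apply Rlt_le, Rinv_0_lt_compat, pow_lt, Hd).
    (* Here [2 |y| <= D / c] by the arithmetic-geometric inequality, and [|y^2 - 3 c^2| <= 3 D];
       this is the origin of [3 / b^2]. *)
    replace (3 / c ^ 2 * c / D) with (D / c * (3 * D) * / D ^ 3) by (field; split; lra).
    apply Rmult_le_compat_r; [apply Rlt_le, Rinv_0_lt_compat, pow_lt, Hd|].
    apply Rmult_le_compat.
    + pose proof (Rabs_pos y). lra.
    + apply Rabs_pos.
    + apply (proj1 (Rle_div_r _ _ c Hb')). unfold D. rewrite <- (pow2_abs y).
      pose proof (pow2_ge_0 (Rabs y - c)). nra.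
    + unfold D. pose proof (pow2_ge_0 y). pose proof (pow2_ge_0 c). apply Rabs_le. lra.
Qed.

(** The primitive [- atan ((x + a) / b)] is the argument of [x + z] up to a constant; dividing by
    [b] rather than by [x + a] keeps it smooth on the whole line. *)
Lemma fourier_ker_im :
  exists (J : nat -> R) (L : R),
    (forall m, is_lim (fun b => RInt (fun x => ker_im x * cos (freq m * x)) 0 b) p_infty (J m)) /\
    is_lim_seq (fun n => sum_f_R0 (fun k => ker_im (INR k)) n
       - (- atan ((INR n + a) / b) - - atan ((0 + a) / b))) L /\
    is_series J ((L - ker_im 0 / 2) / 2).
Proof.
  assert (Hb' : 0 < Rabs b) by now apply Rabs_pos_lt.
  assert (Hb2 := pow2_abs b).
  apply (fourier_kernel (fun x => - atan ((x + a) / b)) ker_im ker_im'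
    (fun x => 2 * b * (b ^ 2 - 3 * (x + a) ^ 2) / ((x + a) ^ 2 + b ^ 2) ^ 3) 1 (/ Rabs b)
    (6 / b ^ 2)).
  - intros x. pose proof (den_pos x). unfold ker_im. auto_derive; [lra|]. field. split; [lra|].
    replace (b * b + (x + a) * (x + a)) with ((x + a) ^ 2 + b ^ 2) by ring. lra.
  - apply ker_im_der.
  - intros x. pose proof (den_pos x). unfold ker_im'. auto_derive.
    + apply Rgt_not_eq. nra.
    + field. lra.
  - intros x Hx. apply abs_div_le; [exact Hx|apply den_pos|].
    rewrite Rabs_Ropp, <- Hb2. pose proof (pow2_ge_0 (x + a - Rabs b)).
    assert (0 < (x + a) * Rabs b) by now apply Rmult_lt_0_compat. lra.
  - intros x Hx. pose proof (den_pos x) as Hd.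
    replace (/ Rabs b / (x + a)) with (1 / (Rabs b * (x + a))) by (field; lra).
    unfold ker_im'. apply abs_div_le; [now apply Rmult_lt_0_compat|now apply pow_lt|].
    rewrite !Rabs_mult, (Rabs_pos_eq 2), (Rabs_pos_eq (x + a)) by lra.
    set (y := x + a) in *. rewrite <- Hb2 in *. set (c := Rabs b) in *.
    assert (Hc : 2 * c * y <= y ^ 2 + c ^ 2) by (pose proof (pow2_ge_0 (y - c)); nra).
    replace ((y ^ 2 + c ^ 2) ^ 2) with ((y ^ 2 + c ^ 2) * (y ^ 2 + c ^ 2)) by ring.
    apply Rmult_le_compat; nra.
  - intros x. pose proof (den_pos x) as Hd.
    unfold Rdiv at 1. rewrite !Rabs_mult, (Rabs_pos_eq 2) by lra. rewrite <- Hb2 in *.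
    set (y := x + a) in *. set (c := Rabs b) in *. set (D := y ^ 2 + c ^ 2) in *.
    rewrite (Rabs_pos_eq (/ D ^ 3)) by (apply Rlt_le, Rinv_0_lt_compat, pow_lt, Hd).
    (* Now [c <= D / c] and [|c^2 - 3 y^2| <= 3 D], whence [6 / b^2]. *)
    replace (6 / c ^ 2 * c / D) with (2 * (D / c) * (3 * D) * / D ^ 3) by (field; split; lra).
    apply Rmult_le_compat_r; [apply Rlt_le, Rinv_0_lt_compat, pow_lt, Hd|].
    apply Rmult_le_compat.
    + lra.
    + apply Rabs_pos.
    + apply Rmult_le_compat_l; [lra|]. apply (proj1 (Rle_div_r _ _ c Hb')). unfold D.
      pose proof (pow2_ge_0 y). nra.
    + unfold D. pose proof (pow2_ge_0 y). pose proof (pow2_ge_0 c). apply Rabs_le. lra.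
Qed.

Lemma Charmonic_ker n :
  Charmonic (a, b) n = (sum_f_R0 (fun k => ker_re (INR k)) n, sum_f_R0 (fun k => ker_im (INR k)) n).
Proof.
  assert (H : forall k, (/ ((a, b) + RtoC (INR k)))%C = (ker_re (INR k), ker_im (INR k))).
  { intros k. unfold Cinv, ker_re, ker_im. apply injective_projections; cbn [fst snd Cplus RtoC].
    - rewrite Rplus_0_r, (Rplus_comm a). reflexivity.
    - rewrite Rplus_0_r, (Rplus_comm a). reflexivity. }
  induction n as [|n IH].
  - cbn [Charmonic sum_f_R0]. rewrite <- (H 0%nat). simpl INR. now rewrite Cplus_0_r.
  - cbn [Charmonic]. rewrite IH, H, !tech5. reflexivity.
Qed.

(** Exchanges the [ln n] of [digamma_seq] for [ln |n + z|], the primitive in the Poisson formula.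
    The index is shifted to keep [INR (S n)] positive. *)
Lemma half_ln_den_lim :
  is_lim_seq (fun n => ln ((INR (S n) + a) ^ 2 + b ^ 2) / 2 - ln (INR (S n))) 0.
Proof.
  apply is_lim_seq_ext with
    (fun n => / 2 * ln ((1 + a * / INR (S n)) ^ 2 + (b * / INR (S n)) ^ 2)).
  - intros n. assert (Hn : 0 < INR (S n)) by (apply lt_0_INR; lia). set (N := INR (S n)) in *.
    pose proof (den_pos N).
    replace ((1 + a * / N) ^ 2 + (b * / N) ^ 2) with (((N + a) ^ 2 + b ^ 2) / (N * N)) by (field; lra).
    rewrite ln_div, ln_mult by (try nra; lra). field.
  - replace 0 with (/ 2 * ln ((1 + a * 0) ^ 2 + (b * 0) ^ 2))
      by (replace ((1 + a * 0) ^ 2 + (b * 0) ^ 2) with 1 by ring; rewrite ln_1; ring).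
    assert (Hinv : is_lim_seq (fun n => / INR (S n)) 0).
    { apply (is_lim_seq_incr_1 (fun n => / INR n)).
      apply (is_lim_seq_inv INR p_infty); [apply is_lim_seq_INR|discriminate]. }
    apply (is_lim_seq_continuous (fun y => / 2 * ln ((1 + a * y) ^ 2 + (b * y) ^ 2))
      (fun n => / INR (S n)) 0); [|exact Hinv].
    apply derivable_continuous_pt, ex_derive_Reals_0. auto_derive. nra.
Qed.

(* The principal logarithm of [(a, b)], with its argument measured from the imaginary axis. *)
Definition log_branch : C :=
  (ln (a ^ 2 + b ^ 2) / 2, (if Rlt_dec 0 b then PI / 2 else - (PI / 2)) - atan (a / b)).

Lemma atan_seq_lim :
  is_lim_seq (fun n => atan ((INR n + a) / b))
    (Finite (if Rlt_dec 0 b then PI / 2 else - (PI / 2))).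
Proof.
  apply (is_lim_seq_comp_INR (fun x => atan ((x + a) / b))).
  destruct (Rlt_dec 0 b) as [H|H]; [now apply atan_lin_lim|].
  apply is_lim_ext with (fun x => - atan ((x + a) / (- b))).
  - intros x. rewrite <- atan_opp. f_equal. field. lra.
  - apply (is_lim_opp _ p_infty (PI / 2)), atan_lin_lim. lra.
Qed.

Lemma kernel_summation :
  exists Jr Ji : nat -> R,
    (forall m, is_lim (fun b => RInt (fun x => ker_re x * cos (freq m * x)) 0 b) p_infty (Jr m)) /\
    (forall m, is_lim (fun b => RInt (fun x => ker_im x * cos (freq m * x)) 0 b) p_infty (Ji m)) /\
    is_series Jr (fst ((log_branch - digamma (a, b) - / (2 * (a, b))) / 2)%C) /\
    is_series Ji (snd ((log_branch - digamma (a, b) - / (2 * (a, b))) / 2)%C).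
Proof.
  destruct fourier_ker_re as [Jr [Lr [H1 [H2 H3]]]].
  destruct fourier_ker_im as [Ji [Li [H4 [H5 H6]]]].
  destruct (digamma_lim (a, b) Hb) as [Hr Hi].
  destruct (digamma (a, b)) as [pr pi]. simpl fst in Hr. simpl snd in Hi.
  (* The harmonic sum enters [digamma_seq] and the Poisson sequence with opposite signs. Adding the
     two sequences and the comparison of logarithms leaves a constant, the primitive at 0; the
     imaginary part works alike. *)
  assert (ELr : Lr = ln (a ^ 2 + b ^ 2) / 2 - pr).
  { apply is_lim_seq_incr_1 in Hr. apply is_lim_seq_incr_1 in H2.
    pose proof (is_lim_seq_plus' _ _ _ _ (is_lim_seq_plus' _ _ _ _ Hr H2) half_ln_den_lim) as E.
    apply is_lim_seq_ext with (v := fun _ => ln (a ^ 2 + b ^ 2) / 2) in E.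
    - apply is_lim_seq_unique in E. rewrite Lim_seq_const in E. injection E as E. simpl. lra.
    - intros n. unfold digamma_seq. rewrite Charmonic_ker. cbn [fst snd Cminus Cplus Copp RtoC]. rewrite (Rplus_0_l a). lra. }
  assert (ELi : Li = snd log_branch - pi).
  { pose proof (is_lim_seq_minus' _ _ _ _ (is_lim_seq_plus' _ _ _ _ Hi H5) atan_seq_lim) as E.
    apply is_lim_seq_ext with (v := fun _ => - atan (a / b)) in E.
    - apply is_lim_seq_unique in E. rewrite Lim_seq_const in E. injection E as E.
      unfold log_branch. simpl snd. lra.
    - intros n. unfold digamma_seq. rewrite Charmonic_ker. cbn [fst snd Cminus Cplus Copp RtoC]. rewrite (Rplus_0_l a). lra. }
  pose proof (den_pos 0) as Hd. rewrite Rplus_0_l in Hd.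
  exists Jr, Ji. split; [exact H1|]. split; [exact H4|]. split.
  - evar_last; [exact H3|]. rewrite ELr. unfold ker_re, log_branch. simpl. field. simpl in Hd. nra.
  - evar_last; [exact H6|]. rewrite ELi. unfold ker_im, log_branch. simpl. field.
    split; [lra|]. simpl in Hd. nra.
Qed.

End Kernel.

(** * The cosine integrals *)

Lemma is_RInt_gen_at_0_infty_pair (f : R -> C) (F G : R -> R) (l m : R) :
  (forall b, is_RInt (fun t => fst (f t)) 0 b (F b)) -> is_lim F p_infty l ->
  (forall b, is_RInt (fun t => snd (f t)) 0 b (G b)) -> is_lim G p_infty m ->
  @is_RInt_gen C_R_NormedModule f (at_point 0) (Rbar_locally p_infty) (l, m).
Proof.
  intros HF Hl HG Hm P [eps HP].
  apply (Filter_prod _ _ _ (fun x => x = 0)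
    (fun b => ball l eps (F b) /\ ball m eps (G b))); [reflexivity| |].
  - apply (filter_and (F := Rbar_locally' p_infty)
      (fun b => ball l eps (F b)) (fun b => ball m eps (G b))).
    + exact (proj1 (filterlim_locally F l) Hl eps).
    + exact (proj1 (filterlim_locally G m) Hm eps).
  - intros x y -> Hy. exists (F y, G y). split.
    + apply (is_RInt_fct_extend_pair (U := R_NormedModule) (V := R_NormedModule)); [apply HF|apply HG].
    + apply HP. exact Hy.
Qed.

(** The [+ 0] is the constant term of the substitution [x = t / freq m], kept in the affine form
    used by [is_RInt_comp_lin]. *)
Lemma is_RInt_cos_scaled (g1 g2 g1' g2' : R -> R) m b :
  (forall x, is_derive g1 x (g1' x)) -> (forall x, is_derive g2 x (g2' x)) ->
  is_RInt (fun t => / 2 * (/ freq m * (g1 (/ freq m * t + 0) * cos t))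
                  + / 2 * (/ freq m * (g2 (/ freq m * t + 0) * cos t))) 0 b
    (/ 2 * RInt (fun x => g1 x * cos (freq m * x)) 0 (/ freq m * b)
     + / 2 * RInt (fun x => g2 x * cos (freq m * x)) 0 (/ freq m * b)).
Proof.
  intros H1 H2. pose proof (freq_pos m).
  assert (Hg : forall g g' : R -> R, (forall x, is_derive g x (g' x)) ->
    is_RInt (fun t => / 2 * (/ freq m * (g (/ freq m * t + 0) * cos t))) 0 b
      (/ 2 * RInt (fun x => g x * cos (freq m * x)) 0 (/ freq m * b))).
  { intros g g' Hd. apply (is_RInt_scal (V := R_NormedModule) _ _ _ (/ 2)).
    apply is_RInt_ext with (fun t => / freq m * (g (/ freq m * t + 0) * cos (freq m * (/ freq m * t + 0)))).
    - intros t _. replace (freq m * (/ freq m * t + 0)) with t by (field; lra). reflexivity.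
    - apply (is_RInt_comp_lin (V := R_NormedModule) (fun x => g x * cos (freq m * x)) (/ freq m) 0 0 b).
      rewrite Rmult_0_r, !Rplus_0_r. apply (is_RInt_cos_int g g' Hd). }
  apply (is_RInt_plus (V := R_NormedModule)); eapply Hg; eassumption.
Qed.

Lemma scaled_lim (F G : R -> R) (l m k : R) :
  0 < k -> is_lim F p_infty l -> is_lim G p_infty m ->
  is_lim (fun b => / 2 * F (k * b) + / 2 * G (k * b)) p_infty (/ 2 * l + / 2 * m).
Proof.
  intros Hk HF HG.
  assert (Hlin : is_lim (fun b => k * b) p_infty p_infty).
  { apply is_lim_ext with (fun x => (x + 0) / (/ k)); [intros x; field; lra|].
    apply is_lim_lin. now apply Rinv_0_lt_compat. }
  assert (H : forall (A : R -> R) (x : R), is_lim A p_infty x ->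
    is_lim (fun b => / 2 * A (k * b)) p_infty (/ 2 * x)).
  { intros A x HA. apply (is_lim_scal_l _ (/ 2) p_infty x).
    apply (is_lim_comp A (fun b => k * b) p_infty x p_infty HA Hlin).
    exists 0. intros; discriminate. }
  apply is_lim_plus'; now apply H.
Qed.

(** Partial fractions: with [w = (a, b)], [f = freq m] and [x = t / f], the denominator is
    [f^2 (x + w) (x - w)], and the numerator contains [x], half the sum of the two factors. Both are
    nonzero for real [x] because [b > 0]. *)
Lemma integrand_eq (u : C) (m : nat) (t : R) :
  0 < Re u ->
  let a := - (Im u / (2 * PI)) in
  let b := Re u / (2 * PI) in
  integrand u (S m) t =
    (/ 2 * (/ freq m * (ker_re a b (/ freq m * t + 0) * cos t))
     + / 2 * (/ freq m * (ker_re (- a) (- b) (/ freq m * t + 0) * cos t)),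
     / 2 * (/ freq m * (ker_im a b (/ freq m * t + 0) * cos t))
     + / 2 * (/ freq m * (ker_im (- a) (- b) (/ freq m * t + 0) * cos t))).
Proof.
  intros Hu a b. pose proof PI_RGT_0. pose proof (freq_pos m) as Hf. set (f := freq m) in *.
  assert (Hb : 0 < b) by (apply Rdiv_lt_0_compat; lra).
  set (x := / f * t + 0).
  assert (Hk : forall a b, b <> 0 -> (ker_re a b x, ker_im a b x) = (/ ((a, b) + RtoC x))%C
               /\ ((a, b) + RtoC x)%C <> 0).
  { intros a' b' Hb'. split.
    - unfold Cinv, ker_re, ker_im. apply injective_projections; cbn [fst snd Cplus RtoC];
        rewrite Rplus_0_r, (Rplus_comm a'); reflexivity.
    - intros E. apply (f_equal snd) in E. simpl in E. lra. }
  destruct (Hk a b) as [H1 H1']; [lra|]. destruct (Hk (- a) (- b)) as [H2 H2']; [lra|].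
  transitivity (/ 2 * (RtoC (/ f * cos t) * ((ker_re a b x, ker_im a b x)
    + (ker_re (- a) (- b) x, ker_im (- a) (- b) x))))%C.
  2:{ rewrite <- (RtoC_inv 2) by lra.
      apply injective_projections; cbn [fst snd Cmult Cplus RtoC]; ring. }
  rewrite H1, H2.
  assert (Hu' : u = (- Ci * RtoC (2 * PI) * (a, b))%C).
  { apply injective_projections; simpl; unfold a, b, Re, Im; field; lra. }
  assert (Hfm : RtoC (INR (S m)) = (RtoC f / RtoC (2 * PI))%C).
  { rewrite <- RtoC_div by lra. f_equal. unfold f, freq. field. lra. }
  assert (Hfx : t = f * x) by (unfold x; field; lra).
  unfold integrand.
  assert (Hden : (RtoC (t ^ 2) + RtoC (INR (S m) ^ 2) * (u * u))%C
    = (RtoC f * RtoC f * (((a, b) + RtoC x) * (((- a)%R, (- b)%R) + RtoC x)))%C).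
  { rewrite RtoC_pow, RtoC_pow, Hfm, Hu'.
    replace (RtoC t) with (RtoC f * RtoC x)%C by (rewrite <- RtoC_mult; congruence).
    assert (HCi : (Ci * Ci)%C = (- (1))%C) by (apply injective_projections; simpl; ring).
    assert (H2P : RtoC (2 * PI) <> 0) by (intros E; apply RtoC_inj in E; lra).
    change ((- a)%R, (- b)%R) with (- (a, b))%C.
    set (w := ((a, b) : C)).
    replace ((RtoC f / RtoC (2 * PI)) ^ 2 * (- Ci * RtoC (2 * PI) * w * (- Ci * RtoC (2 * PI) * w)))%C
      with ((Ci * Ci) * RtoC f * RtoC f * w * w)%C by (field; exact H2P).
    rewrite HCi. ring. }
  rewrite Hden.
  assert (HfC : RtoC f <> 0) by (intros E; apply RtoC_inj in E; lra).
  assert (HS : RtoC x = (/ 2 * (((a, b) + RtoC x) + (((- a)%R, (- b)%R) + RtoC x)))%C).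
  { rewrite <- RtoC_inv by lra. apply injective_projections; simpl; field. }
  rewrite RtoC_mult. replace (RtoC t) with (RtoC f * RtoC x)%C by (rewrite <- RtoC_mult; congruence).
  rewrite RtoC_mult, RtoC_inv by lra. rewrite HS at 1.
  set (p := ((a, b) + RtoC x)%C) in *. set (q := (((- a)%R, (- b)%R) + RtoC x)%C) in *.
  field. now repeat split.
Qed.

Lemma is_series_C (s : nat -> C) (l : C) :
  is_series (fun n => fst (s n)) (fst l) -> is_series (fun n => snd (s n)) (snd l) ->
  @is_series R_AbsRing C_R_NormedModule s l.
Proof.
  intros H1 H2. apply (proj1 (filterlim_Clim _ _)).
  assert (H : forall n, @sum_n C_R_NormedModule s n
    = (sum_n (fun n => fst (s n)) n, sum_n (fun n => snd (s n)) n)).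
  { induction n as [|n IH].
    - rewrite !sum_O. now destruct (s O).
    - rewrite !sum_Sn, IH. reflexivity. }
  apply is_Clim_seq_ext with (fun n => (sum_n (fun n => fst (s n)) n, sum_n (fun n => snd (s n)) n)).
  - intros n. now rewrite H.
  - split; [exact H1|exact H2].
Qed.

Theorem theorem1p2 (u : C) (hu : (0 < Re u)%R) :
  (forall m : nat, (1 <= m)%nat ->
     @ex_RInt_gen C_R_NormedModule (integrand u m) (at_point 0%R) (Rbar_locally p_infty)) /\
  @is_series R_AbsRing C_R_NormedModule
    (fun n : nat => @RInt_gen C_R_CompleteNormedModule (integrand u (S n)) (at_point 0%R) (Rbar_locally p_infty))
    (Cmult (/ 2)
       (Cminus (Clog (Cdiv u (RtoC (2 * PI))))
          (Cmult (/ 2)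
             (Cplus (digamma (Cdiv (Cmult Ci u) (RtoC (2 * PI))))
                    (digamma (Cdiv (Copp (Cmult Ci u)) (RtoC (2 * PI)))))))).
Proof.
  pose proof PI_RGT_0 as HPI.
  pose (a := - (Im u / (2 * PI))). pose (b := Re u / (2 * PI)).
  assert (Hb : 0 < b) by (apply Rdiv_lt_0_compat; lra).
  destruct (kernel_summation a b ltac:(lra)) as [Jr [Ji [Hr [Hi [Sr Si]]]]].
  destruct (kernel_summation (- a) (- b) ltac:(lra)) as [Kr [Ki [Hr' [Hi' [Sr' Si']]]]].
  assert (HI : forall m, @is_RInt_gen C_R_NormedModule (integrand u (S m)) (at_point 0) (Rbar_locally p_infty)
    (/ 2 * Jr m + / 2 * Kr m, / 2 * Ji m + / 2 * Ki m)).
  { intros m. assert (Hf : 0 < / freq m) by apply Rinv_0_lt_compat, freq_pos.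
    apply is_RInt_gen_at_0_infty_pair with
     (fun c => / 2 * RInt (fun x => ker_re a b x * cos (freq m * x)) 0 (/ freq m * c)
     + / 2 * RInt (fun x => ker_re (- a) (- b) x * cos (freq m * x)) 0 (/ freq m * c))
     (fun c => / 2 * RInt (fun x => ker_im a b x * cos (freq m * x)) 0 (/ freq m * c)
     + / 2 * RInt (fun x => ker_im (- a) (- b) x * cos (freq m * x)) 0 (/ freq m * c)).
    - intros c. eapply is_RInt_ext.
      2: apply (is_RInt_cos_scaled _ _ _ _ m c (ker_re_der a b ltac:(lra)) (ker_re_der (- a) (- b) ltac:(lra))).
      intros t _. rewrite (integrand_eq u m t hu). reflexivity.
    - exact (scaled_lim _ _ _ _ _ Hf (Hr m) (Hr' m)).
    - intros c. eapply is_RInt_ext.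
      2: apply (is_RInt_cos_scaled _ _ _ _ m c (ker_im_der a b ltac:(lra)) (ker_im_der (- a) (- b) ltac:(lra))).
      intros t _. rewrite (integrand_eq u m t hu). reflexivity.
    - exact (scaled_lim _ _ _ _ _ Hf (Hi m) (Hi' m)). }
  split.
  { intros [|m] Hm; [lia|]. eexists. apply HI. }
  assert (Ew : (Ci * u / RtoC (2 * PI))%C = (a, b)).
  { unfold Cdiv. rewrite <- RtoC_inv by lra. apply injective_projections; simpl; unfold a, b, Re, Im; field; lra. }
  assert (Ew' : (- (Ci * u) / RtoC (2 * PI))%C = ((- a)%R, (- b)%R)).
  { unfold Cdiv. rewrite <- RtoC_inv by lra. apply injective_projections; simpl; unfold a, b, Re, Im; field; lra. }
  assert (Ev : (u / RtoC (2 * PI))%C = (b, (- a)%R)).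
  { unfold Cdiv. rewrite <- RtoC_inv by lra. apply injective_projections; simpl; unfold a, b, Re, Im; field; lra. }
  rewrite Ew, Ew', Ev.
  (* As [b] and [- b] have opposite signs, the constants [PI / 2] and [- (PI / 2)] cancel and leave
     [- 2 atan (a / b)]. Since [b > 0], the principal argument of [(b, - a)] is [atan (- a / b)], so
     no multiple of [2 PI] intervenes. *)
  assert (Elog : (log_branch a b + log_branch (- a) (- b))%C = (2 * Clog (b, (- a)%R))%C).
  { unfold log_branch, Clog, Carg, Cmod. cbn [fst snd Re Im Cplus].
    destruct (Rlt_dec 0 b) as [_|]; [|lra]. destruct (Rlt_dec 0 (- b)); [lra|].
    assert (Hd : 0 < a ^ 2 + b ^ 2) by (pose proof (pow2_ge_0 a); pose proof (pow_lt b 2 Hb); lra).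
    replace (- a / - b) with (a / b) by (field; lra).
    replace (- a / b) with (- (a / b)) by (field; lra). rewrite atan_opp.
    replace ((- a) ^ 2) with (a ^ 2) by ring. replace ((- b) ^ 2) with (b ^ 2) by ring.
    rewrite (Rplus_comm (b ^ 2)).
    assert (Hln : ln (a ^ 2 + b ^ 2) = 2 * ln (sqrt (a ^ 2 + b ^ 2))).
    { rewrite <- (sqrt_sqrt (a ^ 2 + b ^ 2)) at 1 by lra.
      rewrite ln_mult by now apply sqrt_lt_R0. ring. }
    rewrite Hln.
    apply injective_projections; cbn [fst snd Cmult RtoC]; unfold Cplus; cbn [fst snd]; field. }
  assert (Etot : (/ 2 * (Clog (b, (- a)%R) - / 2 * (digamma (a, b) + digamma ((- a)%R, (- b)%R))))%C
    = (/ 2 * ((log_branch a b - digamma (a, b) - / (2 * (a, b))) / 2)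
      + / 2 * ((log_branch (- a) (- b) - digamma ((- a)%R, (- b)%R) - / (2 * ((- a)%R, (- b)%R))) / 2))%C).
  { replace (log_branch (- a) (- b)) with (2 * Clog (b, (- a)%R) - log_branch a b)%C
      by (rewrite <- Elog; ring).
    change ((- a)%R, (- b)%R) with (- (a, b))%C.
    assert (Hw : ((a, b) : C) <> 0) by (intros E; apply (f_equal snd) in E; simpl in E; lra).
    set (w := ((a, b) : C)) in *.
    generalize (digamma w) (digamma (- w)) (log_branch a b) (Clog (b, (- a)%R)). intros.
    field. exact Hw. }
  rewrite Etot.
  set (A := ((log_branch a b - digamma (a, b) - / (2 * (a, b))) / 2)%C) in *.
  set (B := ((log_branch (- a) (- b) - digamma ((- a)%R, (- b)%R) - / (2 * ((- a)%R, (- b)%R))) / 2)%C) in *.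
  assert (Hs : forall (J K : nat -> R) (x y : R), is_series J x -> is_series K y ->
    is_series (fun n => / 2 * J n + / 2 * K n) (/ 2 * x + / 2 * y)).
  { intros J K x y HJ HK. apply (is_series_plus (V := R_NormedModule)).
    - exact (is_series_scal (K := R_AbsRing) (V := R_NormedModule) (/ 2) J x HJ).
    - exact (is_series_scal (K := R_AbsRing) (V := R_NormedModule) (/ 2) K y HK). }
  apply is_series_C.
  - apply is_series_ext with (fun n => / 2 * Jr n + / 2 * Kr n).
    { intros n. now rewrite (is_RInt_gen_unique (V := C_R_CompleteNormedModule) _ _ (HI n)). }
    evar_last; [apply Hs; eassumption|]. rewrite <- (RtoC_inv 2) by lra. simpl. ring.
  - apply is_series_ext with (fun n => / 2 * Ji n + / 2 * Ki n).
    { intros n. now rewrite (is_RInt_gen_unique (V := C_R_CompleteNormedModule) _ _ (HI n)). }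
    evar_last; [apply Hs; eassumption|]. rewrite <- (RtoC_inv 2) by lra. simpl. ring.
Qed.
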